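(* Consider the piecewise smooth slow-fast Liénard system $$\begin{cases}\dot x=y-F_-(x),\\ \dot y=\epsilon G_-(x),\end{cases}\ x\le 0,\qquad \begin{cases}\dot x=y-F_+(x),\\ \dot y=\epsilon G_+(x),\end{cases}\ x\ge 0,$$ where $0<\epsilon\ll1$, $F_\pm,G_\pm$ are $C^\infty$-smooth and $$F_\pm(0)=F_\pm'(0)=G_\pm(0)=0,\quad F_\pm''(0)>0,\quad G_\pm'(0)<0 .$$ Let $I=I_+-I_-$ be the difference of its slow divergence integrals and suppose that $y^*>0$ is small and $I$ is nonzero on the open interval $]0,y^*[$. Given $y_0\in\,]0,y^*[$, let $U=\{y_0,y_1,y_2,\dots\}$ be the associated entry-exit orbit with initial point $y_0$ (see context). Then the Minkowski dimension $\dim_BU$ exists and $$\dim_BU\in\left\{\frac{m-1}{m+1}\ \Big|\ m=1,2,\dots\right\}\cup\{1\}.$$ If $\dim_BU\neq 0,1$, then $U$ is Minkowski nondegenerate. These results do not depend on the choice of the initial point $y_0\in\,]0,y^*[$.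
   Context: Slow divergence integrals: for $y>0$ small let $\alpha(y)<0<\omega(y)$ be the points near $0$ with $F_-(\alpha(y))=y$, $F_+(\omega(y))=y$, and put $$I_-(y)=-\int_{\alpha(y)}^{0}\frac{F_-'(x)^2}{G_-(x)}\,dx<0,\qquad I_+(y)=-\int_{\omega(y)}^{0}\frac{F_+'(x)^2}{G_+(x)}\,dx<0,\qquad I(y)=I_+(y)-I_-(y).$$ The integrands extend continuously to $x=0$; the functions $I_\pm$ are strictly decreasing and $I_\pm(y)\to0$ as $y\to0^+$. The slow relation function $H$ is defined for small $y>0$ by $I_-(H(y))=I_+(y)$. Orbit: $y^*$ is taken small enough that everything is defined. If $I>0$ on $]0,y^*[$, then $U$ is defined by $I_-(y_{l+1})=I_+(y_l)$, $l\ge0$ (the orbit of $y_0$ by $H$). If $I<0$ on $]0,y^*[$, then $U$ is defined by $I_-(y_l)=I_+(y_{l+1})$, $l\ge0$ (the orbit of $y_0$ by $H^{-1}$). In both cases $U$ tends monotonically to $0$. Minkowski dimension: for bounded $U\subset\mathbb R$ let $|U_\delta|$ be the Lebesgue measure of the closed $\delta$-neighborhood $U_\delta=\{x:\mathrm{dist}(x,U)\le\delta\}$. For $s\ge0$ put $\mathcal M_*^s(U)=\liminf_{\delta\to0}|U_\delta|/\delta^{1-s}$ and $\mathcal M^{*s}(U)=\limsup_{\delta\to0}|U_\delta|/\delta^{1-s}$; $\underline\dim_BU=\inf\{s\ge0:\mathcal M_*^s(U)=0\}$, $\overline\dim_BU=\inf\{s\ge0:\mathcal M^{*s}(U)=0\}$.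 If they coincide, the common value is $\dim_BU$. $U$ is Minkowski nondegenerate if there is $d$ with $0<\mathcal M_*^d(U)\le\mathcal M^{*d}(U)<\infty$ (then $d=\dim_BU$). *)

(* Defs.v *)
From HB Require Import structures.
From mathcomp Require Import all_boot all_order all_algebra.
From mathcomp Require Import all_classical all_reals all_analysis.

Set Implicit Arguments.
Unset Strict Implicit.
Unset Printing Implicit Defensive.

Import Order.TTheory GRing.Theory Num.Theory.
Import numFieldNormedType.Exports.

Local Open Scope ring_scope.
Local Open Scope classical_set_scope.

Section Minkowski.
Context {R : realType}.
Implicit Types (U : set R) (s d : R).

Definition neighborhood U (delta : R) : set R :=
  [set x | (edist_inf U x <= delta%:E)%E].

Definition content_ratio U s (delta : R) : \bar R :=
  ((lebesgue_measure (neighborhood U delta)) / (delta `^ (1 - s))%:E)%E.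

Definition lower_content s U : \bar R := limf_einf (content_ratio U s) 0^'+.

Definition upper_content s U : \bar R := limf_esup (content_ratio U s) 0^'+.

Definition lower_minkowski_dim U : \bar R :=
  ereal_inf [set s%:E | s in [set s | 0 <= s /\ lower_content s U = 0%E]].

Definition upper_minkowski_dim U : \bar R :=
  ereal_inf [set s%:E | s in [set s | 0 <= s /\ upper_content s U = 0%E]].

Definition has_minkowski_dim U d : Prop :=
  lower_minkowski_dim U = d%:E /\ upper_minkowski_dim U = d%:E.

Definition minkowski_nondegenerate U : Prop :=
  exists d, [/\ 0 <= d, (0 < lower_content d U)%E,
    (lower_content d U <= upper_content d U)%E &
    (upper_content d U < +oo)%E].

End Minkowski.

Section SlowFastLienard.
Context {R : realType}.
Implicit Types (F G : R -> R) (y : R).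

Definition smooth (f : R -> R) : Prop :=
  forall (n : nat) (x : R), derivable (f^`(n)) x 1.

(* Conditions on one half (F, G) = (F_-, G_-) or (F_+, G_+) of
   x' = y - F(x), y' = epsilon G(x). *)
Definition lienard_half F G : Prop :=
  [/\ smooth F, smooth G, [/\ F 0 = 0, F^`() 0 = 0 & G 0 = 0],
      0 < F^`(2) 0 & G^`() 0 < 0].

(* The points of the critical curve at height y on either side of the origin.
   Several x may satisfy F x = y; the one nearest to 0 is taken. *)
Definition alpha F y : R := sup [set x | x < 0 /\ F x = y].
Definition omega F y : R := inf [set x | 0 < x /\ F x = y].

(* At x = 0 the quotient below is the totalized 0 / 0 = 0 instead of its
   continuous extension; this does not affect the integrals. *)
Definition divergence_integrand F G (x : R) : R := (derive1 F x) ^+ 2 / G x.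

Definition Iminus F G y : R :=
  - \int[lebesgue_measure]_(x in `[alpha F y, 0]) divergence_integrand F G x.

(* No minus sign: - \int_omega^0 = \int_0^omega since 0 < omega. *)
Definition Iplus F G y : R :=
  \int[lebesgue_measure]_(x in `[0, omega F y]) divergence_integrand F G x.

Definition slow_divergence Fm Gm Fp Gp y : R := Iplus Fp Gp y - Iminus Fm Gm y.

Definition entry_exit_orbit Fm Gm Fp Gp (ystar y0 : R) (u : nat -> R) : Prop :=
  [/\ u 0%N = y0,
      forall l, 0 < u l < ystar,
      (forall y, 0 < y < ystar -> 0 < slow_divergence Fm Gm Fp Gp y) ->
        forall l, Iminus Fm Gm (u l.+1) = Iplus Fp Gp (u l) &
      (forall y, 0 < y < ystar -> slow_divergence Fm Gm Fp Gp y < 0) ->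
        forall l, Iminus Fm Gm (u l) = Iplus Fp Gp (u l.+1)].

End SlowFastLienard.

(* Main.v *)
Require Import Defs.
From HB Require Import structures.
From mathcomp Require Import all_boot all_order all_algebra.
From mathcomp Require Import all_classical all_reals all_analysis.
From mathcomp Require Import measurable_realfun ring lra.
Import Order.TTheory GRing.Theory Num.Theory.
Import numFieldNormedType.Exports.
Local Open Scope ring_scope.
Local Open Scope classical_set_scope.

(** Write [A] for one of the two slow divergence integrals and use [r = sqrt y]
    as a variable.  In terms of the abscissa [x], [A] is the primitive of the
    integrand [F' ^ 2 / G], which is [x] times a quotient of smooth functions,
    and the relation [F x = r ^ 2] reads [x = r * u x] with
    [u x = 1 / sqrt (F x / x ^ 2)], because [F] vanishes to order exactly 2.
    Substituting this equation into itself gains one power of [r] each time, so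
    [x], and with it [A], has expansions in powers of [r] to all orders
    ([Iplus_divergence_germ]; the left half is the mirror image of a right half,
    [Iminus_divergence_germ]).  Moreover [dA/dy = F' / G] stays between two
    negative constants, so [A] is bi-Lipschitz.

    The orbit equation says that the increment of one integral between two
    consecutive points is, up to sign, the value of the difference [I] at the
    first of them.
    Bi-Lipschitz bounds turn this into: the gap [y_l - y_(l+1)] is comparable to
    [|I (y_l)|] ([orbit_gap]).  Comparing the expansions of the two integrals
    ([expands_power_or_flat]), either [|I y|] is comparable to [y ^ (k / 2)]
    for the index [k] of the first coefficient on which they differ, with
    [k >= 2] since both integrals are [O(y)], or [I] is [O(y ^ a)] for every [a].

    A sequence decreasing to 0 with gaps comparable to [y ^ a], [a > 1], has a
    [delta]-neighborhood of measure comparable to [delta ^ (1 / a)]: below the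
    height [delta ^ (1 / a)] the gaps are filled, above it there are
    [O(delta ^ (1 / a - 1))] points ([measure_neighborhood_le],
    [measure_neighborhood_ge]).  This gives dimension [1 - 1 / a], hence
    [(k - 2) / k = (m - 1) / (m + 1)] with [m = k - 1], and nondegeneracy when
    [k > 2].  For [k = 2] the upper estimate holds for every [a > 1] and the
    dimension is 0; in the flat case the lower estimate holds for arbitrarily
    large [a] and the dimension is 1.  Nothing depends on the initial point. *)

(** * Expansions at 0 from the right, to finite order *)

Section Expansions.
Context {R : realType}.
Implicit Types (f g : R -> R) (p : {poly R}) (N : nat) (x y r : R).

Lemma near0P (P : R -> Prop) :
  (\forall x \near 0^'+, P x) <->
  exists2 e : R, 0 < e & forall x : R, 0 < x -> x < e -> P x.
Proof.
split.
  move=> [e /= e0 H]; exists e => // x x0 xe; apply: H => //=.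
  by rewrite sub0r normrN gtr0_norm.
move=> [e e0 H]; exists e => //= x /= + x0.
by rewrite sub0r normrN gtr0_norm // => xe; exact: H.
Qed.

Lemma near0_lt (e : R) : 0 < e -> \forall x \near (0 : R)^'+, 0 < x < e.
Proof. by move=> e0; apply/near0P; exists e => // x -> ->. Qed.

Lemma near0_and (P Q : R -> Prop) : (\forall x \near 0^'+, P x) ->
  (\forall x \near 0^'+, Q x) -> \forall x \near 0^'+, P x /\ Q x.
Proof. by move=> HP HQ; exact: filterI. Qed.

Lemma near0_ex (P : R -> Prop) :
  (\forall x \near 0^'+, P x) -> exists x, P x.
Proof.
move=> /near0P[e e0 H]; exists (e / 2); apply: H; first exact: divr_gt0.
by rewrite ltr_pdivrMr // ltr_pMr // ltr1n.
Qed.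

(** The remainder is [O(x ^+ N)], not [o(x ^+ N)]: order 0 is then mere
    boundedness, which is the base case of the inductions on [N] below, and a
    factor [x] raises the order by exactly one. *)
Definition expands N f :=
  exists p (C : R), \forall x \near 0^'+, `|f x - p.[x]| <= C * x ^+ N.

Lemma expands_pos N f : expands N f ->
  exists p (C : R), 0 < C /\
    \forall x \near 0^'+, `|f x - p.[x]| <= C * x ^+ N.
Proof.
move=> [p [C H]]; exists p, (`|C| + 1); split; first by rewrite ltr_wpDl.
move: H (near0_lt _ (@ltr01 R)); apply: filterS2 => x fx /andP[x0 x1].
apply: (le_trans fx); rewrite ler_wpM2r ?exprn_ge0 ?ltW//.
by rewrite (le_lt_trans (ler_norm _)) // ltrDl.
Qed.

Lemma near_expands N f g : (\forall x \near 0^'+, f x = g x) ->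
  expands N f -> expands N g.
Proof.
move=> fg [p [C H]]; exists p, C; move: fg H.
by apply: filterS2 => x ->.
Qed.

Lemma expands_horner N p : expands N (horner p).
Proof.
exists p, 0; apply: filterE => x; by rewrite subrr normr0 mul0r.
Qed.

Lemma expands_cst N (a : R) : expands N (fun=> a).
Proof.
apply: near_expands (expands_horner N a%:P).
by apply: filterE => x; rewrite hornerC.
Qed.

Lemma expands_le M N f : (N <= M)%N -> expands M f -> expands N f.
Proof.
move=> NM /expands_pos[p [C [C0 H]]]; exists p, C.
move: H (near0_lt _ (@ltr01 R)); apply: filterS2 => x fx /andP[x0 x1].
apply: (le_trans fx); rewrite ler_pM2l //.
by rewrite ler_wiXn2l // ltW.
Qed.

Lemma horner_bounded p :
  exists2 K : R, 0 < K & forall x : R, 0 <= x <= 1 -> `|p.[x]| <= K.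
Proof.
elim/poly_ind: p => [|p c [K K0 IH]].
  by exists 1 => // x _; rewrite horner0 normr0.
exists (K + `|c|); first by rewrite ltr_pwDl.
move=> x /[dup] x01 /andP[x0 x1].
rewrite hornerMXaddC (le_trans (ler_normD _ _)) // lerD2r normrM.
by rewrite -[leRHS]mulr1 ler_pM // ?IH // ger0_norm.
Qed.

Lemma expands_bounded N f : expands N f ->
  exists2 K : R, 0 < K & \forall x \near 0^'+, `|f x| <= K.
Proof.
move=> /(expands_le _ _ _ (leq0n _)) /expands_pos[p [C [C0 H]]].
have [K K0 HK] := horner_bounded p.
exists (K + C); first by rewrite addr_gt0.
move: H (near0_lt _ (@ltr01 R)); apply: filterS2 => x fx /andP[x0 x1].
rewrite expr0 mulr1 in fx.
rewrite -(subrK p.[x] (f x)) (le_trans (ler_normD _ _)) // addrC lerD //.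
by rewrite HK // !ltW.
Qed.

Lemma bounded_expands0 f (K : R) :
  (\forall x \near 0^'+, `|f x| <= K) -> expands 0 f.
Proof.
move=> fK; exists 0, K; move: fK; apply: filterS => x.
by rewrite horner0 subr0 expr0 mulr1.
Qed.

Lemma expandsD N f g : expands N f -> expands N g ->
  expands N (fun x => f x + g x).
Proof.
move=> [p [C Hf]] [q [D Hg]]; exists (p + q), (C + D).
move: Hf Hg; apply: filterS2 => x fx gx; rewrite hornerD.
have -> : f x + g x - (p.[x] + q.[x]) = (f x - p.[x]) + (g x - q.[x]) by ring.
by rewrite (le_trans (ler_normD _ _)) // mulrDl lerD.
Qed.

Lemma expandsM N f g : expands N f -> expands N g ->
  expands N (fun x => f x * g x).
Proof.
move=> /[dup] /expands_bounded[K K0 fK] [p [C Hf]] [q [D Hg]].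
have [L L0 pL] := horner_bounded q.
exists (p * q), (K * D + L * C).
move: (near0_and _ _ Hf Hg) fK (near0_lt _ (@ltr01 R)).
apply: filterS3 => x [fx gx] {}fK /andP[x0 x1]; rewrite hornerM.
have -> : f x * g x - p.[x] * q.[x] =
  f x * (g x - q.[x]) + q.[x] * (f x - p.[x]) by ring.
rewrite (le_trans (ler_normD _ _)) // mulrDl !normrM -!mulrA.
apply: lerD; apply: ler_pM => //.
by rewrite pL // !ltW.
Qed.

Lemma expandsN N f : expands N f -> expands N (fun x => - f x).
Proof.
move=> /(expandsM _ _ _ (expands_cst N (-1))).
by apply: near_expands; apply: filterE => x; rewrite mulN1r.
Qed.

Lemma expands_horner_comp N f p : expands N f -> expands N (fun x => p.[f x]).
Proof.
move=> Hf; elim/poly_ind: p => [|p c IH].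
  apply: near_expands (expands_cst N 0).
  by apply: filterE => x; rewrite horner0.
apply: near_expands (expandsD _ _ _ (expandsM _ _ _ IH Hf) (expands_cst N c)).
by apply: filterE => x; rewrite hornerMXaddC.
Qed.

(** Reciprocals, square roots and inverse functions are all expanded from a fixed
    point equation whose right-hand side carries a factor [x], so that this lemma
    drives the induction on the order. *)
Lemma expands_mulX N f : expands N f -> expands N.+1 (fun x => x * f x).
Proof.
move=> [p [C H]]; exists (p * 'X), C.
move: H (near0_lt _ (@ltr01 R)); apply: filterS2 => x fx /andP[x0 x1].
rewrite hornerMX [p.[x] * x]mulrC -mulrBr normrM gtr0_norm // exprS.
by rewrite mulrCA ler_pM2l.
Qed.

Lemma expands_divX N f : expands N.+1 f ->
  exists a : R, expands N (fun x => (f x - a) / x) /\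
    exists K : R, \forall x \near 0^'+, `|f x - a| <= K * x.
Proof.
move=> [p [C H]]; exists p.[0].
have /factor_theorem[q qE] : root (p - p.[0]%:P) 0.
  by rewrite rootE hornerD hornerN hornerC subrr.
have fE (x : R) : f x - p.[0] = (f x - p.[x]) + q.[x] * x.
  have := congr1 (horner^~ x) qE.
  rewrite hornerD hornerN hornerC hornerM hornerD hornerN hornerX hornerC subr0.
  by move=> <-; ring.
have E : expands N (fun x => (f x - p.[0]) / x).
  exists q, C; move: H (near0_lt _ (@ltr01 R)); apply: filterS2 => x fx /andP[x0 x1].
  rewrite fE mulrDl mulfK ?gt_eqF // addrK normrM normfV (gtr0_norm x0).
  by rewrite ler_pdivrMr // -mulrA -exprSr.
split=> //; have [K K0 HK] := expands_bounded _ _ E; exists K.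
move: HK (near0_lt _ (@ltr01 R)); apply: filterS2 => x fx /andP[x0 x1].
by move: fx; rewrite normrM normfV (gtr0_norm x0) ler_pdivrMr.
Qed.

Lemma expands_limit_ge (f : R -> R) (a c K : R) :
  (\forall x \near 0^'+, `|f x - a| <= K * x) ->
  (\forall x \near 0^'+, c <= f x) -> c <= a.
Proof.
move=> fa cf; apply/ler_addgt0Pr => e e0.
have K0 : 0 < e / (`|K| + 1) by rewrite divr_gt0 // ltr_wpDl.
have [x [[H1 H2] /andP[x0 xe]]] : exists x,
    (`|f x - a| <= K * x /\ c <= f x) /\ 0 < x < e / (`|K| + 1).
  exact/near0_ex/(near0_and _ _ (near0_and _ _ fa cf) (near0_lt _ K0)).
apply: (le_trans H2); rewrite -lerBlDl.
apply: (le_trans (ler_norm _)); apply: (le_trans H1).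
move: xe; rewrite ltr_pdivlMr ?ltr_wpDl // mulrC => /ltW; apply: le_trans.
rewrite ler_pM2r //; apply: (le_trans (ler_norm _)); by rewrite lerDl.
Qed.

(** With [f = a + x * g] one has [1 / f = 1 / a - (x / a) * g * (1 / f)]. *)
Lemma expandsV N f (c : R) : 0 < c -> (\forall x \near 0^'+, c <= f x) ->
  expands N f -> expands N (fun x => (f x)^-1).
Proof.
move=> c0 cf; elim: N => [_|N IH fN1].
  apply: (bounded_expands0 _ c^-1); move: cf; apply: filterS => x cfx.
  have fx0 : 0 < f x by apply: lt_le_trans cfx.
  by rewrite normfV gtr0_norm // lef_pV2 // posrE.
have [a [gN [K fa]]] := expands_divX _ _ fN1.
have a0 : 0 < a by apply: lt_le_trans c0 (expands_limit_ge f _ _ _ fa cf).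
have := expandsM _ _ _ gN (IH (expands_le _ _ _ (leqnSn N) fN1)).
move/expands_mulX/(expandsM _ _ _ (expands_cst _ (- a^-1))).
move/(expandsD _ _ _ (expands_cst _ a^-1)).
apply: near_expands.
move: cf (near0_lt _ (@ltr01 R)); apply: filterS2 => x cfx /andP[x0 x1].
have fx0 : 0 < f x by apply: lt_le_trans cfx.
by field; rewrite !gt_eqF.
Qed.

(** With [f = a + x * g] one has
    [sqrt f = sqrt a + x * g / (sqrt f + sqrt a)]. *)
Lemma expands_sqrt N f (c : R) : 0 < c -> (\forall x \near 0^'+, c <= f x) ->
  expands N f -> expands N (fun x => Num.sqrt (f x)).
Proof.
move=> c0 cf; elim: N => [|N IH fN1].
  move=> /expands_bounded[K K0 fK].
  apply: (bounded_expands0 _ (Num.sqrt K)); move: fK; apply: filterS => x {}fK.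
  by rewrite ger0_norm ?sqrtr_ge0 // ler_wsqrtr // (le_trans (ler_norm _)).
have [a [gN [K fa]]] := expands_divX _ _ fN1.
have a0 : 0 < a by apply: lt_le_trans c0 (expands_limit_ge f _ _ _ fa cf).
have sa0 : 0 < Num.sqrt a by rewrite sqrtr_gt0.
have dN : expands N (fun x => (Num.sqrt (f x) + Num.sqrt a)^-1).
  apply: (expandsV _ _ (Num.sqrt a)) => //.
    by apply: filterE => x; rewrite lerDr sqrtr_ge0.
  exact: expandsD (IH (expands_le _ _ _ (leqnSn N) fN1)) (expands_cst _ _).
have := expandsM _ _ _ gN dN.
move/expands_mulX/(expandsD _ _ _ (expands_cst _ (Num.sqrt a))).
apply: near_expands.
move: cf (near0_lt _ (@ltr01 R)); apply: filterS2 => x cfx /andP[x0 x1].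
have fx0 : 0 < f x by apply: lt_le_trans cfx.
have s0 : 0 < Num.sqrt (f x) + Num.sqrt a by rewrite ltr_wpDl ?sqrtr_ge0.
have E : f x - a = (Num.sqrt (f x) - Num.sqrt a) * (Num.sqrt (f x) + Num.sqrt a).
  by rewrite -subr_sqr !sqr_sqrtr // ltW.
rewrite E; field; by rewrite !gt_eqF.
Qed.

(** As [g = O(r)], the remainder [O(g r ^+ N)] is [O(r ^+ N)], and what is left is
    a polynomial in [g]. *)
Lemma expands_comp N f g (K : R) :
  (\forall r \near 0^'+, 0 < g r <= K * r) ->
  expands N f -> expands N g -> expands N (fun r => f (g r)).
Proof.
move=> gK /expands_pos[p [C [C0 fp]]] /(expands_horner_comp _ _ p) [q [D pq]].
move/near0P: fp => [e e0 fp].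
exists q, (C * `|K| ^+ N + D).
have e1 : 0 < e / (`|K| + 1) by rewrite divr_gt0 // ltr_wpDl.
move: pq gK (near0_lt _ e1); apply: filterS3 => r pq /andP[g0 gK] /andP[r0 re].
have gK' : g r <= `|K| * r by rewrite (le_trans gK) // ler_wpM2r ?ler_norm ?ltW.
have ge : g r < e.
  rewrite (le_lt_trans gK') //; move: re; rewrite ltr_pdivlMr ?ltr_wpDl //.
  by apply: le_lt_trans; rewrite mulrDr mulr1 mulrC lerDl ltW.
rewrite -(subrKA p.[g r]) (le_trans (ler_normD _ _)) // mulrDl lerD //.
rewrite (le_trans (fp _ g0 ge)) // -mulrA ler_pM2l // -exprMn.
by rewrite lerXn2r // nnegrE ?mulr_ge0 // ltW.
Qed.

(** Used for inverse functions: an expansion of [g] to order [N], put in the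
    right-hand side [r * u (g r)], gives one to order [N.+1]. *)
Lemma expands_fixpoint N u g (K : R) :
  (\forall r \near 0^'+, 0 < g r <= K * r) ->
  (\forall r \near 0^'+, g r = r * u (g r)) ->
  (forall M, expands M u) -> expands N g.
Proof.
move=> gK gE uM; elim: N => [|N IH].
  apply: (bounded_expands0 _ `|K|).
  move: gK (near0_lt _ (@ltr01 R)); apply: filterS2 => r /andP[g0 gK] /andP[r0 r1].
  rewrite gtr0_norm // (le_trans gK) // (le_trans (ler_norm _)) // normrM.
  by rewrite (gtr0_norm r0) ler_piMr // ltW.
apply: near_expands (expands_mulX _ _ (expands_comp _ _ _ K gK (uM N) IH)).
by move: gE; apply: filterS => r <-.
Qed.

Lemma antideriv_poly p : exists q : {poly R}, deriv q = p.
Proof.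
exists (\sum_(i < size p) (p`_i / i.+1%:R) *: 'X^(i.+1)).
rewrite raddf_sum /= -[RHS]coefK poly_def; apply: eq_bigr => i _.
by rewrite derivZ derivXn /= -scalerMnr scalerMnl -mulr_natr divfK ?pnatr_eq0.
Qed.

Lemma expands_antideriv N f (df : R -> R) :
  (\forall x \near 0^'+, is_derive (x : R) (1 : R) f (df x)) -> f x @[x --> 0^'+] --> f 0 ->
  expands N df -> expands N.+1 f.
Proof.
move=> fdf f0 /expands_pos[p [C [C0 Hp]]].
have [q qp] := antideriv_poly p.
exists (q + (f 0 - q.[0])%:P), C.
have /near0P[e e0 H] := near0_and _ _ fdf Hp.
apply/near0P; exists e => // x x0 xe.
pose g y := f y - q.[y].
have dg (y : R) : y \in `]0, x[%R -> is_derive y 1 g (df y - p.[y]).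
  rewrite in_itv /= => /andP[y0 yx].
  have [fy _] := H _ y0 (lt_trans yx xe).
  have qy : is_derive y 1 (horner q) p.[y] by rewrite -qp; exact: is_derive_poly.
  exact: is_deriveB.
have cg : {within `[0, x], continuous g}.
  have cq : continuous (horner q) by exact: continuous_horner.
  apply/continuous_within_itvP => //; split.
  - move=> y /dg [/derivable1_diffP/differentiable_continuous] //.
  - by apply: cvgB => //; apply: cvg_at_right_filter; exact: cq.
  - apply: cvg_at_left_filter; apply: cvgB; last exact: cq.
    by have [[/derivable1_diffP/differentiable_continuous]] := H _ x0 xe.
have [c + gE] := MVT x0 dg cg.
rewrite in_itv /= => /andP[c0 cx].
rewrite hornerD hornerC.
have -> : f x - (q.[x] + (f 0 - q.[0])) = g x - g 0 by rewrite /g; ring.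
rewrite gE subr0 normrM (gtr0_norm x0) exprSr mulrA ler_pM2r //.
have [_ /le_trans] := H _ c0 (lt_trans cx xe); apply.
by rewrite ler_pM2l // lerXn2r // ?nnegrE ltW.
Qed.

Lemma smooth_derive f : smooth f -> smooth f^`().
Proof.
move=> sf n x; have := sf n.+1 x.
suff -> : f^`(n.+1) = (f^`())^`(n) by [].
by rewrite /derive1n iterSr.
Qed.

(** Taylor's theorem, by integrating the expansion of the derivative. *)
Lemma smooth_expands N f : smooth f -> expands N f.
Proof.
elim: N f => [|N IH] f sf.
  have cf : {for 0, continuous f}.
    exact/differentiable_continuous/derivable1_diffP/(sf 0%N).
  have /cvgrPdist_lt/(_ _ ltr01) := @cvg_at_right_filter _ _ f 0 (f 0) cf.
  move=> H; apply: (bounded_expands0 _ (`|f 0| + 1)).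
  move: H; apply: filterS => y fy.
  rewrite -[f y](subrK (f 0)) (le_trans (ler_normD _ _)) //.
  by rewrite addrC lerD2l distrC ltW.
apply: (expands_antideriv _ _ f^`()); last exact/IH/smooth_derive.
  apply: filterE => x; rewrite derive1E; apply/derivableP.
  exact: (sf 0%N).
apply: cvg_at_right_filter.
exact/differentiable_continuous/derivable1_diffP/(sf 0%N).
Qed.

End Expansions.

(** * The slow divergence integral of one half of the system *)

Section Half.
Context {R : realType}.
Implicit Types (F G A : R -> R) (x y z : R).

Lemma derive_linear_bounds (f : R -> R) :
  derivable f 0 1 -> f 0 = 0 -> 0 < derive1 f 0 ->
  \forall x \near 0^'+, derive1 f 0 / 2 * x <= f x <= 2 * derive1 f 0 * x.
Proof.
move=> df f0 d0.
have H : h^-1 *: (f (h + 0) - f 0) @[h --> 0^'] --> derive1 f 0.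
  have := df; rewrite derive1E /derive /derivable /= => H.
  have E : (fun h : R => h^-1 *: (f (h%:A + 0) - f 0)) =
           (fun h : R => h^-1 *: (f (h + 0) - f 0)).
    by apply/funext => h; rewrite -[h%:A]/(h * 1) mulr1.
  by move: H; rewrite /= E.
have Hr := cvg_dnbhs_at_right H.
have d2 : 0 < derive1 f 0 / 2 by rewrite divr_gt0.
have /cvgrPdist_le/(_ _ d2) Hd := Hr.
move: Hd (near0_lt _ (@ltr01 R)); apply: filterS2 => x + /andP[x0 x1].
rewrite addr0 f0 subr0 ler_distl => /andP[H1 H2].
have -> : f x = (x^-1 *: f x) * x.
  by rewrite -[x^-1 *: f x]/(x^-1 * f x) mulrC mulrA mulfV ?mul1r // gt_eqF.
apply/andP; split; rewrite ler_pM2r //; lra.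
Qed.

Lemma smooth_is_derive (f : R -> R) (x : R) :
  smooth f -> is_derive x (1 : R) f (derive1 f x).
Proof. by move=> sf; rewrite derive1E; apply/derivableP; exact: (sf 0%N). Qed.

Lemma smooth_continuous (f : R -> R) : smooth f -> continuous f.
Proof.
by move=> sf x; exact/differentiable_continuous/derivable1_diffP/(sf 0%N).
Qed.

Lemma expands_divX0 N (f : R -> R) (K : R) : expands N.+1 f ->
  (\forall x \near 0^'+, `|f x| <= K * x) -> expands N (fun x => f x / x).
Proof.
move=> fN fK; have [a [gN [L fa]]] := expands_divX _ _ fN.
suff a0 : a = 0.
  by apply: near_expands gN; apply: filterE => x; rewrite a0 subr0.
have aK : \forall x \near 0^'+, `|0 - a| <= (K + L) * x.
  move: fK fa; apply: filterS2 => x H1 H2.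
  have -> : 0 - a = (f x - a) - f x by ring.
  by rewrite (le_trans (ler_normB _ _)) // mulrDl addrC lerD.
have zge0 : \forall x \near (0 : R)^'+, (0 : R) <= 0 by exact: filterE.
apply/eqP; rewrite eq_le; apply/andP; split; last first.
  exact: (expands_limit_ge (fun=> 0) _ _ _ aK zge0).
rewrite -oppr_ge0; apply: (expands_limit_ge (fun=> 0) _ _ (K + L) _ zge0).
by move: aK; apply: filterS => x; rewrite !sub0r normrN opprK.
Qed.

Definition germ_bounds A (y1 K1 K2 : R) :=
  [/\ 0 < y1, 0 < K1, 0 < K2,
      forall y' y, 0 < y' -> y' < y -> y < y1 ->
        K1 * (y - y') <= A y' - A y <= K2 * (y - y') &
      forall y, 0 < y -> y < y1 -> K1 * y <= - A y <= K2 * y].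

(** What the orbit analysis uses of a slow divergence integral [A]: near
    0 it is bi-Lipschitz, decreasing, vanishes at 0, and has expansions to all
    orders in [r = sqrt y]. *)
Definition divergence_germ A :=
  (exists y1 K1 K2 : R, germ_bounds A y1 K1 K2) /\
  forall N, expands N (fun r => A (r ^+ 2)).

(** The sign conditions on [F''] and [G'] at 0, as estimates on an interval. *)
Definition half_bounds F G (e c C : R) :=
  [/\ 0 < e, 0 < c, 0 < C & forall x, 0 < x -> x < e ->
    c * x <= derive1 F x <= C * x /\ c * x <= - G x <= C * x].

Lemma lienard_half_bounds F G : lienard_half F G ->
  exists e c C, half_bounds F G e c C.
Proof.
move=> [sF sG [F0 dF0 G0] d2F dG].
have H1 := derive_linear_bounds _ (sF 1%N 0) dF0 d2F.
have dNG : derivable (fun x => - G x) 0 1 by apply: derivableN; exact: (sG 0%N).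
have dNGE : derive1 (fun x => - G x) 0 = - derive1 G 0.
  by rewrite !derive1E deriveN //; exact: (sG 0%N).
have NG0 : - G 0 = 0 by rewrite G0 oppr0.
have dNG0 : 0 < derive1 (fun x => - G x) 0 by rewrite dNGE oppr_gt0.
have H2 := derive_linear_bounds _ dNG NG0 dNG0.
have /near0P[e e0 H] := near0_and _ _ H1 H2.
set a := derive1n 2 F 0 in H1 d2F H; set b := derive1 _ 0 in H2 dNG0 H.
have ab0 : 0 < Num.min a b by rewrite lt_min d2F.
exists e, (Num.min a b / 2), (2 * Num.max a b); split => //.
- by rewrite divr_gt0.
- by rewrite mulr_gt0 // lt_max d2F.
move=> x x0 xe; have [/andP[h1 h2] /andP[h3 h4]] := H _ x0 xe.
have ma : Num.min a b <= a by rewrite ge_min lexx.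
have mb : Num.min a b <= b by rewrite ge_min lexx orbT.
have Ma : a <= Num.max a b by rewrite le_max lexx.
have Mb : b <= Num.max a b by rewrite le_max lexx orbT.
split; apply/andP; split.
- by apply: le_trans h1; rewrite ler_pM2r // ler_pM2r.
- by apply: (le_trans h2); rewrite ler_pM2r // ler_pM2l.
- by apply: le_trans h3; rewrite ler_pM2r // ler_pM2r.
- by apply: (le_trans h4); rewrite ler_pM2r // ler_pM2l.
Qed.

Section HalfFixed.
Context (F G : R -> R) (e c C : R).
Context (hFG : lienard_half F G) (hb : half_bounds F G e c C).

Let sF : smooth F. Proof. by case: hFG. Qed.
Let sG : smooth G. Proof. by case: hFG. Qed.
Let e0 : 0 < e. Proof. by case: hb. Qed.
Let c0 : 0 < c. Proof. by case: hb. Qed.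
Let C0 : 0 < C. Proof. by case: hb. Qed.
Let F00 : F 0 = 0. Proof. by case: hFG => _ _ []. Qed.
Let dF00 : derive1 F 0 = 0. Proof. by case: hFG => _ _ []. Qed.
Let bnd x : 0 < x -> x < e ->
  c * x <= derive1 F x <= C * x /\ c * x <= - G x <= C * x.
Proof. by case: hb => _ _ _; exact. Qed.
Let dF_gt0 x : 0 < x -> x < e -> 0 < derive1 F x.
Proof.
move=> x0 xe; have [/andP[h _] _] := bnd x x0 xe.
by apply: lt_le_trans h; rewrite mulr_gt0.
Qed.
Let G_lt0 x : 0 < x -> x < e -> G x < 0.
Proof.
move=> x0 xe; have [_ /andP[h _]] := bnd x x0 xe.
by rewrite -oppr_gt0; apply: lt_le_trans h; rewrite mulr_gt0.
Qed.

Let MVT_F x y : 0 <= x -> x < y -> y < e ->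
  exists z, [/\ x < z, z < y & F y - F x = derive1 F z * (y - x)].
Proof.
move=> x0 xy ye.
have [|z] := MVT xy (fun z _ => smooth_is_derive F z sF).
  by apply: continuous_subspaceT; exact: smooth_continuous.
by rewrite in_itv /= => /andP[xz zy] E; exists z.
Qed.

Lemma half_increasing x y : 0 <= x -> x < y -> y < e -> F x < F y.
Proof.
move=> x0 xy ye; have [z [xz zy E]] := MVT_F x y x0 xy ye.
rewrite -subr_gt0 E mulr_gt0 ?subr_gt0 //.
by apply: dF_gt0; [exact: le_lt_trans xz|exact: lt_trans ye].
Qed.

Let F_quadratic x : 0 < x -> x < e -> c / 4 * x ^+ 2 <= F x <= C * x ^+ 2.
Proof.
move=> x0 xe; have x20 : 0 < x / 2 by rewrite divr_gt0.
have x2x : x / 2 < x by rewrite ltr_pdivrMr // ltr_pMr // ltr1n.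
apply/andP; split.
  have [z [xz zx E]] := MVT_F _ _ (ltW x20) x2x xe.
  have F20 : 0 < F (x / 2).
    by rewrite -F00; apply: half_increasing => //; exact: lt_trans xe.
  have [/andP[h _] _] := bnd _ (lt_trans x20 xz) (lt_trans zx xe).
  have : c * (x / 2) * (x / 2) <= F x - F (x / 2).
    rewrite E; have -> : x - x / 2 = x / 2 by field.
    by rewrite ler_pM2r // (le_trans _ h) // ler_pM2l // ltW.
  have -> : c * (x / 2) * (x / 2) = c / 4 * x ^+ 2 by field.
  by move/le_trans; apply; rewrite gerBl ltW.
have [z [z0 zx E]] := MVT_F _ _ (lexx 0) x0 xe.
have [/andP[_ h] _] := bnd _ z0 (lt_trans zx xe).
move: E; rewrite F00 !subr0 => ->; rewrite expr2 mulrA ler_pM2r //.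
by rewrite (le_trans h) // ler_pM2l // ltW.
Qed.

Lemma omegaK x : 0 < x -> x < e -> omega F (F x) = x.
Proof.
move=> x0 xe; have lbx : lbound [set z | 0 < z /\ F z = F x] x.
  move=> z /= [z0 Fz]; rewrite leNgt; apply/negP => zx.
  by have := half_increasing _ _ (ltW z0) zx xe; rewrite Fz ltxx.
rewrite /omega; apply/eqP; rewrite eq_le; apply/andP; split.
  by apply: ge_inf; [exists x|split].
apply: lb_le_inf; last exact: lbx.
by exists x; split.
Qed.

Lemma half_preimage x1 y : 0 < x1 -> 0 < y -> y < F x1 ->
  exists x, [/\ 0 < x, x < x1 & F x = y].
Proof.
move=> x10 y0 yF.
have cF : {within `[0, x1], continuous F}.
  by apply: continuous_subspaceT; exact: smooth_continuous.
have : Num.min (F 0) (F x1) <= y <= Num.max (F 0) (F x1).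
  by rewrite F00 ge_min le_max (ltW y0) (ltW yF) orbT.
move=> /(IVT (ltW x10) cF)[x]; rewrite in_itv /= => /andP[x0 xx1] Fx.
exists x; split => //.
  rewrite lt_neqAle x0 andbT; apply/eqP => x0E.
  by move: y0; rewrite -Fx -x0E F00 ltxx.
rewrite lt_neqAle xx1 andbT; apply/eqP => xE.
by move: yF; rewrite -Fx -xE ltxx.
Qed.

Notation h := (divergence_integrand F G).

Let h0 : h 0 = 0. Proof. by rewrite /divergence_integrand dF00 expr0n mul0r. Qed.

Let h_bound x : 0 < x -> x < e -> `|h x| <= C ^+ 2 / c * x.
Proof.
move=> x0 xe; have [/andP[h1 h2] /andP[h3 h4]] := bnd _ x0 xe.
have G0 := G_lt0 _ x0 xe; have dF0 := dF_gt0 _ x0 xe.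
rewrite /divergence_integrand normrM normfV (ltr0_norm G0) normrX (gtr0_norm dF0).
rewrite ler_pdivrMr ?oppr_gt0 //.
apply: (@le_trans _ _ ((C * x) ^+ 2)).
  by rewrite lerXn2r ?nnegrE ?mulr_ge0 // ltW.
have -> : (C * x) ^+ 2 = C ^+ 2 / c * x * (c * x) by field; rewrite gt_eqF.
by rewrite ler_pM2l // mulr_gt0 // divr_gt0 // exprn_gt0.
Qed.

Let h_cont x : 0 < x -> x < e -> {for x, continuous h}.
Proof.
move=> x0 xe; rewrite /divergence_integrand.
apply: (@cvgM _ _ (nbhs x)).
  apply: (@cvg_comp _ _ _ (derive1 F) (fun z : R => z ^+ 2)); last exact: exprn_continuous.
  exact: (smooth_continuous _ (smooth_derive _ sF)).
apply: cvgV; first by rewrite lt_eqF // G_lt0.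
exact: smooth_continuous.
Qed.

Let h_right0 : h x @[x --> 0^'+] --> h 0.
Proof.
rewrite h0; apply/cvgrPdist_le => eps eps0.
have K0 : 0 < C ^+ 2 / c by rewrite divr_gt0 // exprn_gt0.
have d0 : 0 < eps / (C ^+ 2 / c) by rewrite divr_gt0.
move: (near0_lt _ d0) (near0_lt _ e0); apply: filterS2 => x /andP[x0 xd] /andP[_ xe].
rewrite sub0r normrN (le_trans (h_bound _ x0 xe)) //.
by move: xd; rewrite ltr_pdivlMr // mulrC => /ltW.
Qed.

Lemma integrand_continuous x : 0 < x -> x < e -> {within `[0, x], continuous h}.
Proof.
move=> x0 xe; apply/continuous_within_itvP => //; split.
- move=> z; rewrite in_itv /= => /andP[z0 zx]; apply: h_cont => //.
  exact: lt_trans xe.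
- exact: h_right0.
- exact/cvg_at_left_filter/h_cont.
Qed.

Let h_integrable x : 0 < x -> x < e ->
  (@lebesgue_measure R).-integrable `[0, x] (EFin \o h).
Proof.
move=> x0 xe; apply: continuous_compact_integrable; first exact: segment_compact.
exact: integrand_continuous.
Qed.

Let J (x : R) : R := \int[lebesgue_measure]_(t in `[0, x]) h t.

Let J0 : J 0 = 0.
Proof. by rewrite /J set_itv1 Rintegral_set1. Qed.

Let J_derive x : 0 < x -> x < e -> is_derive x (1 : R) J (h x).
Proof.
move=> x0 xe; pose u := (x + e) / 2.
have xu : x < u by rewrite /u; lra.
have ue : u < e by rewrite /u; lra.
have [dJ <-] := continuous_FTC1_closed xu (h_integrable _ (lt_trans x0 xu) ue) x0
  (h_cont _ x0 xe).
by rewrite derive1E; exact/derivableP.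
Qed.

Let J_within x : 0 < x -> x < e -> {within `[0, x], continuous J}.
Proof.
move=> x0 xe; apply: (parameterized_integral_continuous (ltW x0)).
exact: h_integrable.
Qed.

(** [F' / (- G)] lies between [c / C] and [C / c], and it is the ratio of the
    derivatives of [- J] and [F]. *)
Let J_half_increasingements x y : 0 <= x -> x < y -> y < e ->
  c / C * (F y - F x) <= J x - J y <= C / c * (F y - F x).
Proof.
move=> x0 xy ye.
have E k : exists z, [/\ x < z, z < y &
    J y + k * F y - (J x + k * F x) = (h z + k * derive1 F z) * (y - x)].
  have dD z : z \in `]x, y[%R ->
      is_derive z (1 : R) (fun t => J t + k * F t) (h z + k * derive1 F z).
    rewrite in_itv /= => /andP[xz zy].
    have ? := J_derive _ (le_lt_trans x0 xz) (lt_trans zy ye).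
    have ? := smooth_is_derive F z sF.
    exact: is_deriveD.
  have [|z] := MVT xy dD.
    move=> z; apply: cvgD.
      have sub : `[x, y] `<=` `[0, y] by apply: subset_itvr; rewrite bnd_simp.
      exact: (continuous_subspaceW sub (J_within _ (le_lt_trans x0 xy) ye)).
    apply: cvgM; first exact: cvg_cst.
    by apply: continuous_subspaceT; exact: smooth_continuous.
  by rewrite in_itv /= => /andP[xz zy] H; exists z.
have yx0 : 0 < y - x by rewrite subr_gt0.
have K x' : h x' = - (derive1 F x' * (derive1 F x' / - G x')).
  by rewrite /divergence_integrand invrN mulrN mulrN opprK expr2 mulrA.
have P z : x < z -> z < y ->
    0 < derive1 F z /\ c / C <= derive1 F z / - G z <= C / c.
  move=> xz zy; have z0 := le_lt_trans x0 xz; have ze := lt_trans zy ye.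
  split; first exact: dF_gt0.
  have [/andP[h1 h2] /andP[h3 h4]] := bnd _ z0 ze.
  have G0 : 0 < - G z by rewrite oppr_gt0 G_lt0.
  rewrite ler_pdivlMr // ler_pdivrMr //; apply/andP; split.
    by apply: le_trans h1; rewrite mulrAC ler_pdivrMr // [leRHS]mulrAC -mulrA ler_pM2l.
  apply: (le_trans h2); rewrite [leRHS]mulrAC ler_pdivlMr // -mulrA ler_pM2l //.
  by rewrite mulrC.
apply/andP; split.
  have [z [xz zy Ez]] := E (c / C); have [d0 /andP[q1 q2]] := P z xz zy.
  suff : J y + c / C * F y - (J x + c / C * F x) <= 0 by lra.
  rewrite Ez mulr_le0_ge0 ?(ltW yx0) // K addrC subr_le0 mulrC.
  by rewrite ler_pM2l.
have [z [xz zy Ez]] := E (C / c); have [d0 /andP[q1 q2]] := P z xz zy.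
suff : 0 <= J y + C / c * F y - (J x + C / c * F x) by lra.
rewrite Ez mulr_ge0 ?(ltW yx0) // K addrC subr_ge0 [leRHS]mulrC.
by rewrite ler_pM2l.
Qed.

Let near_e : \forall x \near 0^'+, 0 < x < e. Proof. exact: near0_lt. Qed.

Let expands_dF N : expands N (fun x => derive1 F x / x).
Proof.
apply: (expands_divX0 _ _ C); first exact/smooth_expands/smooth_derive.
move: near_e; apply: filterS => x /andP[x0 xe].
by have [/andP[_ h2] _] := bnd _ x0 xe; rewrite gtr0_norm ?dF_gt0.
Qed.

Let expands_G N : expands N (fun x => - G x / x).
Proof.
apply: (expands_divX0 _ _ C); first exact/expandsN/smooth_expands.
move: near_e; apply: filterS => x /andP[x0 xe].
by have [_ /andP[_ h2]] := bnd _ x0 xe; rewrite gtr0_norm ?oppr_gt0 ?G_lt0.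
Qed.

Let expands_F N : expands N (fun x => F x / x / x).
Proof.
apply: (expands_divX0 _ _ C); [apply: (expands_divX0 _ _ C)|].
- exact: smooth_expands.
- move: near_e (near0_lt _ (@ltr01 R)); apply: filterS2 => x /andP[x0 xe] /andP[_ x1].
  have /andP[h1 h2] := F_quadratic _ x0 xe.
  rewrite ger0_norm; last by apply: le_trans h1; rewrite mulr_ge0 ?divr_ge0 ?exprn_ge0 // ltW.
  apply: (le_trans h2); rewrite ler_pM2l // expr2.
  by rewrite ler_piMr // ltW.
- move: near_e; apply: filterS => x /andP[x0 xe].
  have /andP[h1 h2] := F_quadratic _ x0 xe.
  rewrite ger0_norm; last first.
    rewrite divr_ge0 ?(ltW x0) //.
    by apply: le_trans h1; rewrite mulr_ge0 ?divr_ge0 ?exprn_ge0 // ltW.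
  by rewrite ler_pdivrMr // -mulrA -expr2.
Qed.

Let expands_integrand N : expands N h.
Proof.
have Gc : \forall x \near 0^'+, c <= - G x / x.
  move: near_e; apply: filterS => x /andP[x0 xe].
  by have [_ /andP[h1 _]] := bnd _ x0 xe; rewrite ler_pdivlMr.
have := expandsM _ _ _ (expandsM _ _ _ (expands_dF N) (expands_dF N))
  (expandsV _ _ _ c0 Gc (expands_G N)).
move=> /expands_mulX/expandsN/(expands_le _ _ _ (leqnSn N)).
apply: near_expands.
move: near_e; apply: filterS => x /andP[x0 xe].
have G0 := G_lt0 _ x0 xe.
rewrite /divergence_integrand; field.
by rewrite (gt_eqF x0) (lt_eqF G0).
Qed.

Let expands_J N : expands N J.
Proof.
apply: (expands_le _ _ _ (leqnSn N)).
apply: (expands_antideriv _ _ h); last exact: expands_integrand.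
  by move: near_e; apply: filterS => x /andP[x0 xe]; exact: J_derive.
have e20 : 0 < e / 2 by rewrite divr_gt0.
have e2e : e / 2 < e by rewrite ltr_pdivrMr // ltr_pMr // ltr1n.
by have /(continuous_within_itvP _ e20) [] := J_within _ e20 e2e.
Qed.

(** [omega] in the variable [r = sqrt y] solves [x = r * u x] with
    [u x = 1 / sqrt (F x / x ^+ 2)]. *)
Let u x := (Num.sqrt (F x / x / x))^-1.

Let c4 : 0 < c / 4. Proof. by rewrite divr_gt0. Qed.

Let Fxx_ge x : 0 < x -> x < e -> c / 4 <= F x / x / x.
Proof.
move=> x0 xe; have /andP[h1 h2] := F_quadratic _ x0 xe.
by rewrite ler_pdivlMr // ler_pdivlMr // -mulrA -expr2.
Qed.

Let expands_u N : expands N u.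
Proof.
have Fc : \forall x \near 0^'+, c / 4 <= F x / x / x.
  by move: near_e; apply: filterS => x /andP[x0 xe]; exact: Fxx_ge.
have s0 : 0 < Num.sqrt (c / 4) by rewrite sqrtr_gt0.
apply: (expandsV _ _ _ s0); last exact: (expands_sqrt _ _ _ c4 Fc (expands_F N)).
by move: Fc; apply: filterS => x Fc; rewrite ler_wsqrtr.
Qed.

Let near_preimage : \forall r \near 0^'+, 0 < r /\
  exists x, [/\ 0 < x, x < e & F x = r ^+ 2].
Proof.
pose x1 := e / 2.
have x10 : 0 < x1 by rewrite divr_gt0.
have x1e : x1 < e by rewrite ltr_pdivrMr // ltr_pMr // ltr1n.
have Fx1 : 0 < F x1 by rewrite -F00; exact: half_increasing.
have Fx1' : 0 < Num.sqrt (F x1) by rewrite sqrtr_gt0.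
move: (near0_lt _ Fx1'); apply: filterS => r /andP[r0 rF]; split => //.
have r2F : r ^+ 2 < F x1.
  by rewrite -[ltRHS]sqr_sqrtr ?ltW // ltr_pXn2r // nnegrE ltW.
have [x [x0 xx1 Fx]] := half_preimage _ _ x10 (exprn_gt0 2 r0) r2F.
by exists x; split => //; exact: lt_trans x1e.
Qed.

Let preimageE x r : 0 < r -> 0 < x -> x < e -> F x = r ^+ 2 -> x = r * u x.
Proof.
move=> r0 x0 xe Fx; rewrite /u.
have -> : F x / x / x = (r / x) ^+ 2.
  by rewrite Fx; field; rewrite gt_eqF.
by rewrite sqrtr_sqr gtr0_norm ?divr_gt0 // invf_div mulrC divfK // gt_eqF.
Qed.

Let omega_bound : \forall r \near 0^'+,
  0 < omega F (r ^+ 2) <= (Num.sqrt (c / 4))^-1 * r.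
Proof.
move: near_preimage; apply: filterS => r [r0 [x [x0 xe Fx]]].
rewrite -Fx omegaK // x0 /= {1}(preimageE _ _ r0 x0 xe Fx) mulrC ler_pM2r //.
have s0 : 0 < Num.sqrt (c / 4) by rewrite sqrtr_gt0.
have sx : Num.sqrt (c / 4) <= Num.sqrt (F x / x / x).
  by rewrite ler_wsqrtr // Fxx_ge.
by rewrite lef_pV2 // posrE // (lt_le_trans s0).
Qed.

Let expands_omega N : expands N (fun r => omega F (r ^+ 2)).
Proof.
apply: (expands_fixpoint _ u _ _ omega_bound _ expands_u).
move: near_preimage; apply: filterS => r [r0 [x [x0 xe Fx]]].
by rewrite -Fx omegaK //; exact: preimageE.
Qed.

Let IplusE x : 0 < x -> x < e -> Iplus F G (F x) = J x.
Proof. by move=> x0 xe; rewrite /Iplus omegaK. Qed.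

Lemma half_divergence_germ : divergence_germ (Iplus F G).
Proof.
pose x1 := e / 2.
have x10 : 0 < x1 by rewrite divr_gt0.
have x1e : x1 < e by rewrite ltr_pdivrMr // ltr_pMr // ltr1n.
have cC : 0 < c / C by rewrite divr_gt0.
have Cc : 0 < C / c by rewrite divr_gt0.
split.
  exists (F x1), (c / C), (C / c); split => //.
  - by rewrite -F00; exact: half_increasing.
  - move=> y' y y'0 y'y yF.
    have [x' [x'0 x'x1 Fx']] := half_preimage _ _ x10 y'0 (lt_trans y'y yF).
    have [x [x0 xx1 Fx]] := half_preimage _ _ x10 (lt_trans y'0 y'y) yF.
    have x'x : x' < x.
      rewrite ltNge; apply/negP; rewrite le_eqVlt => /orP[/eqP xx'|xx'].
        by move: y'y; rewrite -Fx -Fx' xx' ltxx.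
      have := half_increasing _ _ (ltW x0) xx' (lt_trans x'x1 x1e).
      by rewrite Fx Fx' => /(lt_trans y'y); rewrite ltxx.
    rewrite -Fx -Fx' !IplusE ?(lt_trans _ x1e) //.
    by apply: J_half_increasingements => //; [exact: ltW|exact: lt_trans x1e].
  - move=> y y0 yF.
    have [x [x0 xx1 Fx]] := half_preimage _ _ x10 y0 yF.
    rewrite -Fx IplusE ?(lt_trans _ x1e) //.
    have := J_half_increasingements 0 x (lexx 0) x0 (lt_trans xx1 x1e).
    by rewrite F00 J0 subr0 sub0r.
move=> N.
apply: near_expands (expands_comp _ _ _ _ omega_bound (expands_J N) (expands_omega N)).
move: near_preimage; apply: filterS => r [r0 [x [x0 xe Fx]]].
by rewrite -Fx omegaK // IplusE.
Qed.

End HalfFixed.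

Lemma Iplus_divergence_germ F G :
  lienard_half F G -> divergence_germ (Iplus F G).
Proof.
move=> hFG; have [e [c [C hb]]] := lienard_half_bounds _ _ hFG.
exact: half_divergence_germ hFG hb.
Qed.

End Half.

(** * The left half, by reflection *)

Section Reflection.
Context {R : realType}.
Implicit Types (F G A : R -> R) (x y z : R).


Definition reflect_even F x : R := F (- x).
Definition reflect_odd G x : R := - G (- x).

Lemma is_derive_reflect F x : derivable F (- x) 1 ->
  is_derive x (1 : R) (reflect_even F) (- derive1 F (- x)).
Proof.
move=> dF; have ? : is_derive (- x) (1 : R) F (derive1 F (- x)).
  by rewrite derive1E; exact/derivableP.
have ? : is_derive x (1 : R) (fun z : R => - z) (- 1) by exact: is_deriveN.
have : is_derive x (1 : R) (F \o (fun z : R => - z)) (derive1 F (- x) * (- 1)).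
  exact: is_derive1_comp.
by rewrite mulrN1.
Qed.

Lemma derive1n_reflect F n : smooth F ->
  derive1n n (reflect_even F) = fun x => (-1) ^+ n * derive1n n F (- x).
Proof.
move=> sF; elim: n => [|n IH].
  by apply/funext => x; rewrite expr0 mul1r.
rewrite derive1nS IH; apply/funext => x; rewrite derive1E.
have ? := is_derive_reflect (derive1n n F) x (sF n (- x)).
have H : is_derive x (1 : R) (fun y => (-1) ^+ n * reflect_even (derive1n n F) y)
    ((-1) ^+ n *: (- derive1 (derive1n n F) (- x))).
  exact: is_deriveZ.
rewrite (@derive_val _ _ _ _ _ _ _ H) exprS mulN1r mulNr.
by rewrite -[_ *: _]/(_ * _) mulrN derive1nS.
Qed.

Lemma smooth_reflect_even F : smooth F -> smooth (reflect_even F).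
Proof.
move=> sF n x; rewrite derive1n_reflect //.
have ? := is_derive_reflect (derive1n n F) x (sF n (- x)).
have H : is_derive x (1 : R) (fun y => (-1) ^+ n * reflect_even (derive1n n F) y)
    ((-1) ^+ n *: (- derive1 (derive1n n F) (- x))).
  exact: is_deriveZ.
exact: (@ex_derive _ _ _ _ _ _ _ H).
Qed.

Lemma smooth_opp F : smooth F -> smooth (fun x => - F x).
Proof.
move=> sF n.
suff E : derive1n n (fun x => - F x) = fun x => - derive1n n F x.
  by move=> x; rewrite E; apply: derivableN; exact: sF.
elim: n => [//|n IH]; rewrite derive1nS IH; apply/funext => x.
by rewrite derive1nS !derive1E deriveN //; exact: sF.
Qed.

Lemma derive1_reflect_even F x : smooth F ->
  derive1 (reflect_even F) x = - derive1 F (- x).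
Proof.
move=> sF; have H := is_derive_reflect F x (sF 0%N _).
by rewrite derive1E (@derive_val _ _ _ _ _ _ _ H).
Qed.

Lemma lienard_half_reflect F G :
  lienard_half F G -> lienard_half (reflect_even F) (reflect_odd G).
Proof.
move=> [sF sG [F0 dF0 G0] d2F dG]; split.
- exact: smooth_reflect_even.
- exact/smooth_opp/smooth_reflect_even.
- split; first by rewrite /reflect_even oppr0.
    by rewrite derive1_reflect_even // oppr0 dF0 oppr0.
  by rewrite /reflect_odd oppr0 G0 oppr0.
- by rewrite derive1n_reflect // oppr0 sqrrN expr1n mul1r.
- rewrite derive1E deriveN; last exact: (smooth_reflect_even _ sG 0%N).
  by rewrite -derive1E derive1_reflect_even // opprK oppr0.
Qed.

Lemma alpha_omega F (y : R) : alpha F y = - omega (reflect_even F) y.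
Proof.
rewrite /alpha /omega /inf opprK; congr sup.
apply/seteqP; split => [x /= [x0 Fx]|x /= [z [z0 Fz] <-]].
  by exists (- x); rewrite ?opprK // oppr_gt0 /reflect_even opprK.
by rewrite oppr_lt0.
Qed.

(** The substitution [x := - x]; under it [F' ^+ 2] is unchanged and the two minus
    signs, that of [Iminus] and that of [reflect_odd], cancel. *)
Lemma Iminus_reflect F G : lienard_half F G -> \forall y \near 0^'+,
  Iminus F G y = Iplus (reflect_even F) (reflect_odd G) y.
Proof.
move=> hFG; have hr := lienard_half_reflect _ _ hFG.
have [e [c [C hb]]] := lienard_half_bounds _ _ hr.
have [e0 c0 _ hbd] := hb; have [sF _ _ _ _] := hFG.
set Fr := reflect_even F in hr hb *; set Gr := reflect_odd G in hr hb *.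
have e20 : 0 < e / 2 by rewrite divr_gt0.
have e2e : e / 2 < e by rewrite ltr_pdivrMr // ltr_pMr // ltr1n.
have Fe : 0 < Fr (e / 2).
  rewrite -[ltLHS](_ : Fr 0 = 0); last by case: hr => _ _ [].
  exact: (half_increasing _ _ _ _ _ hr hb _ _ (lexx 0) e20 e2e).
move: (near0_lt _ Fe); apply: filterS => y /andP[y0 yF].
have [x [x0 xe Fx]] := half_preimage _ _ hr _ _ e20 y0 yF.
have {}xe : x < e by exact: lt_trans e2e.
rewrite /Iminus alpha_omega /Iplus -/Fr -Fx (omegaK _ _ _ _ _ hr hb) //.
have hc : {within `[(- 0)%R, (- - x)%R], continuous (divergence_integrand Fr Gr)}.
  by rewrite oppr0 opprK; exact: (integrand_continuous _ _ _ _ _ hr hb).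
have x0' : - x <= 0 by rewrite oppr_le0 ltW.
have := integration_by_substitution_oppr x0' hc.
rewrite oppr0 opprK /Rintegral => ->.
rewrite -fineN -integral_ge0N; last first.
  move=> z /=; rewrite in_itv /= => /andP[xz z0]; rewrite lee_fin.
  rewrite /divergence_integrand divr_ge0 ?sqr_ge0 //.
  move: z0; rewrite le_eqVlt => /orP[/eqP ->|z0].
    by case: hFG => _ _ [_ _ ->].
  have zx : - z < e by rewrite (le_lt_trans _ xe) // lerNl.
  have z0' : 0 < - z by rewrite oppr_gt0.
  have [_ /andP[+ _]] := hbd _ z0' zx.
  rewrite /Gr /reflect_odd !opprK; apply: le_trans.
  by rewrite ltW // mulr_gt0.
congr fine; apply: eq_integral => z _ /=. congr EFin.
rewrite /divergence_integrand /Fr derive1_reflect_even // opprK sqrrN.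
by rewrite /Gr /reflect_odd opprK invrN mulrN.
Qed.

Lemma near_divergence_germ A B : (\forall y \near (0 : R)^'+, A y = B y) ->
  divergence_germ B -> divergence_germ A.
Proof.
move=> /near0P[e e0 AB] [[y1 [K1 [K2 [y10 K10 K20 H1 H2]]]] H3]; split.
  exists (Num.min e y1), K1, K2; split => //; first by rewrite lt_min e0.
    move=> y' y y'0 y'y; rewrite lt_min => /andP[ye yy1].
    by rewrite !AB ?H1 // ?(lt_trans y'0) // (lt_trans y'y).
  by move=> y y0; rewrite lt_min => /andP[ye yy1]; rewrite AB ?H2.
move=> N; apply: near_expands (H3 N).
have se0 : 0 < Num.sqrt e by rewrite sqrtr_gt0.
move: (near0_lt _ se0); apply: filterS => r /andP[r0 re].
rewrite AB ?exprn_gt0 //.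
by rewrite -[ltRHS]sqr_sqrtr ?ltW // ltr_pXn2r // nnegrE ltW.
Qed.

Lemma Iminus_divergence_germ F G :
  lienard_half F G -> divergence_germ (Iminus F G).
Proof.
move=> hFG; apply: (near_divergence_germ _ _ (Iminus_reflect _ _ hFG)).
exact/Iplus_divergence_germ/lienard_half_reflect.
Qed.

End Reflection.

(** * Minkowski contents from bounds on the measure of neighborhoods *)

Section Contents.
Context {R : realType}.
Implicit Types (U : set R) (s d c C delta : R).

Lemma limf_esup_le_cst (f : R -> \bar R) (b : \bar R) :
  (\forall x \near (0 : R)^'+, (f x <= b)%E) -> (limf_esup f 0^'+ <= b)%E.
Proof.
move=> H; rewrite limf_esupE; apply: ereal_inf_le.
exists (ereal_sup (f @` [set x | (f x <= b)%E])); first by exists [set x | (f x <= b)%E].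
by apply: ge_ereal_sup => _ [x fx <-].
Qed.

Lemma limf_einf_ge_cst (f : R -> \bar R) (b : \bar R) :
  (\forall x \near (0 : R)^'+, (b <= f x)%E) -> (b <= limf_einf f 0^'+)%E.
Proof.
move=> H; rewrite limf_einfE; apply: le_ereal_sup_tmp.
exists (ereal_inf (f @` [set x | (b <= f x)%E])); first by exists [set x | (b <= f x)%E].
by apply: le_ereal_inf_tmp => _ [x fx <-].
Qed.

Lemma limf_einf_le_esup (f : R -> \bar R) :
  (limf_einf f (0 : R)^'+ <= limf_esup f 0^'+)%E.
Proof.
rewrite limf_einfE limf_esupE; apply: ge_ereal_sup => _ [V V0 <-].
apply: le_ereal_inf_tmp => _ [W W0 <-].
have [x [Vx Wx]] := near0_ex _ (near0_and _ _ V0 W0).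
apply: (@le_trans _ _ (f x)); first by apply: ereal_inf_lbound; exists x.
by apply: ereal_sup_ubound; exists x.
Qed.

Notation mu := (@lebesgue_measure R).

Lemma content_ratioE U s delta : 0 < delta ->
  content_ratio U s delta =
  (mu (Defs.neighborhood U delta) * ((delta `^ (1 - s))^-1)%:E)%E.
Proof.
by move=> d0; rewrite /content_ratio inver gt_eqF // powR_gt0.
Qed.

Lemma content_ratio_ge0 U s delta : 0 < delta ->
  (0 <= content_ratio U s delta)%E.
Proof.
move=> d0; rewrite content_ratioE //; apply: mule_ge0; first exact: measure_ge0.
by rewrite lee_fin invr_ge0 powR_ge0.
Qed.

Lemma lower_content_ge0 U s : (0 <= lower_content s U)%E.
Proof.
apply: limf_einf_ge_cst.
by apply: filterS (near0_lt _ (@ltr01 R)) => x /andP[x0 _]; exact: content_ratio_ge0.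
Qed.

Lemma lower_content_le_upper U s : (lower_content s U <= upper_content s U)%E.
Proof. exact: limf_einf_le_esup. Qed.

Lemma upper_content_le U s C :
  (\forall delta \near (0 : R)^'+,
    (mu (Defs.neighborhood U delta) <= (C * delta `^ (1 - s))%:E)%E) ->
  (upper_content s U <= C%:E)%E.
Proof.
move=> H; apply: limf_esup_le_cst.
move: H (near0_lt _ (@ltr01 R)); apply: filterS2 => x Hx /andP[x0 _].
by rewrite content_ratioE // lee_pdivrMr ?powR_gt0 // -EFinM.
Qed.

Lemma lower_content_ge U s c :
  (\forall delta \near (0 : R)^'+,
    ((c * delta `^ (1 - s))%:E <= mu (Defs.neighborhood U delta))%E) ->
  (c%:E <= lower_content s U)%E.
Proof.
move=> H; apply: limf_einf_ge_cst.
move: H (near0_lt _ (@ltr01 R)); apply: filterS2 => x Hx /andP[x0 _].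
by rewrite content_ratioE // lee_pdivlMr ?powR_gt0 // -EFinM.
Qed.

Lemma lower_dim_le_upper U :
  (lower_minkowski_dim U <= upper_minkowski_dim U)%E.
Proof.
apply: ereal_inf_le_tmp => _ [s /= [s0 Us] <-]; exists s => //; split => //.
apply/eqP; rewrite eq_le lower_content_ge0 andbT -Us.
exact: lower_content_le_upper.
Qed.

Lemma lower_dim_ge0 U : (0 <= lower_minkowski_dim U)%E.
Proof. by apply: le_ereal_inf_tmp => _ [s [s0 _] <-]; rewrite lee_fin. Qed.

(** If [|U_delta| = O(delta ^ (1 - d))], the ratio at an exponent [s > d] is
    [O(delta ^ (s - d))]. *)
Lemma upper_dim_le U d C : 0 <= d -> 0 < C ->
  (\forall delta \near (0 : R)^'+,
    (mu (Defs.neighborhood U delta) <= (C * delta `^ (1 - d))%:E)%E) ->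
  (upper_minkowski_dim U <= d%:E)%E.
Proof.
move=> d0 C0 H; apply/lee_addgt0Pr => eps eps0; rewrite -EFinD.
apply: ereal_inf_lbound; exists (d + eps) => //; split; first by rewrite addr_ge0 // ltW.
apply/eqP; rewrite eq_le; apply/andP; split; last first.
  exact: le_trans (lower_content_ge0 _ _) (lower_content_le_upper _ _).
apply/lee_addgt0Pr => e e0; rewrite add0e; apply: upper_content_le.
have eC : 0 < e / C by rewrite divr_gt0.
have /cvgrPdist_le/(_ _ eC) Hp := powR_cvg0 eps0.
move: H Hp (near0_lt _ (@ltr01 R)); apply: filterS3 => x Hx.
rewrite sub0r normrN ger0_norm ?powR_ge0 // => xe /andP[x0 _].
apply: (le_trans Hx); rewrite lee_fin.
have -> : 1 - d = eps + (1 - (d + eps)) by ring.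
rewrite powRD; last by rewrite (gt_eqF x0) /= implybT.
by rewrite mulrA ler_pM2r ?powR_gt0 // mulrC -ler_pdivlMr.
Qed.

Lemma lower_dim_ge U d c : 0 < c ->
  (\forall delta \near (0 : R)^'+,
    ((c * delta `^ (1 - d))%:E <= mu (Defs.neighborhood U delta))%E) ->
  (d%:E <= lower_minkowski_dim U)%E.
Proof.
move=> c0 H; apply: le_ereal_inf_tmp => _ [s [s0 Us] <-]; rewrite lee_fin.
rewrite leNgt; apply/negP => sd.
suff : (c%:E <= lower_content s U)%E by rewrite Us lee_fin leNgt c0.
apply: lower_content_ge.
move: H (near0_lt _ (@ltr01 R)); apply: filterS2 => x Hx /andP[x0 x1].
apply: le_trans Hx; rewrite lee_fin ler_pM2l //.
by apply: ger_powR; [rewrite x0 ltW|rewrite lerD2l lerN2 ltW].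
Qed.

End Contents.

(** * Neighborhoods of a decreasing sequence with power-like gaps *)

Section Sequences.
Context {R : realType}.
Implicit Types (u : nat -> R) (x y a c C eta delta : R) (U : set R).

Notation mu := (@lebesgue_measure R).

Lemma neighborhood_measurable U delta : measurable (Defs.neighborhood U delta).
Proof.
apply: closed_measurable.
apply: (@preimage_closed _ _ (edist_inf U) [set x | (x <= delta%:E)%E]).
  by move=> x _; exact: edist_inf_continuous.
exact: closed_ereal_ge_ereal.
Qed.

Lemma neighborhood_ball U delta x y : U y -> `|x - y| < delta ->
  Defs.neighborhood U delta x.
Proof.
move=> Uy xy; apply: (@le_trans _ _ (edist (x, y))).
  by apply: ereal_inf_lbound; exists y.
by apply: edist_fin => //; exact: le_lt_trans xy.
Qed.

Lemma neighborhood_ex U delta e x : delta < e -> Defs.neighborhood U delta x ->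
  exists2 y, U y & `|x - y| < e.
Proof.
move=> de Ux; have : (edist_inf U x < e%:E)%E.
  by apply: le_lt_trans Ux _; rewrite lte_fin.
by move=> /ereal_inf_lt[_ [y Uy <-]] /edist_lt_ball; exists y.
Qed.

Lemma measure_segment x y : x <= y -> mu `[x, y] = (y - x)%:E.
Proof.
rewrite le_eqVlt => /predU1P[->|xy].
  by rewrite set_itv1 lebesgue_measure_set1 subrr.
by rewrite lebesgue_measure_itv /= lte_fin xy EFinB.
Qed.

Lemma measure_balls_le u (e : R) N : 0 < e ->
  (mu (\big[setU/set0]_(l < N) `[(u l - e)%R, (u l + e)%R]) <=
    (N%:R * (2 * e))%:E)%E.
Proof.
move=> e0; elim: N => [|N IH]; first by rewrite big_ord0 measure0 mul0r.
rewrite big_ord_recr /=; apply: (le_trans (measureU2 _ _ _)) => //.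
  by apply: bigsetU_measurable => i _; exact: measurable_itv.
rewrite -natr1 mulrDl mul1r EFinD; apply: leeD => //.
apply: (@le_trans _ _ (mu `[(u N - e)%R, (u N + e)%R])); first exact: lexx.
by rewrite measure_segment ?lee_fin; lra.
Qed.

(** Bernoulli's inequality for a negative real exponent. *)
Lemma powRN_ge x a : 0 < x -> 0 <= a -> 1 + a * (1 - x) <= x `^ (- a).
Proof.
move=> x0 a0; rewrite /powR gt_eqF //.
apply: le_trans (expR_ge1Dx _); rewrite lerD2l mulNr -mulrN ler_wpM2l //.
rewrite lerNr opprB.
have := @le_ln1Dx R (x - 1); rewrite (_ : 1 + (x - 1) = x); last by ring.
by apply; rewrite ltrBrDl subrr.
Qed.

(** The potential [y `^ (1 - a)] grows by a definite amount along a step of size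
    at least [c * y `^ a]; the number of steps needed to get below [y] is thus
    [O(y `^ (1 - a))]. *)
Lemma potential_step x y a c : 1 < a -> 0 < c -> 0 < x -> 0 < y ->
  c * y `^ a <= y - x -> y `^ (1 - a) + (a - 1) * c <= x `^ (1 - a).
Proof.
move=> a1 c0 x0 y0 gap.
have b0 : 0 < a - 1 by rewrite subr_gt0.
have xy0 : 0 < x / y by rewrite divr_gt0.
have B := powRN_ge _ _ xy0 (ltW b0).
have -> : x `^ (1 - a) = y `^ (1 - a) * (x / y) `^ (- (a - 1)).
  rewrite opprB -powRM ?(ltW y0) ?(ltW xy0) //.
  by rewrite mulrC divfK // gt_eqF.
apply: (@le_trans _ _ (y `^ (1 - a) * (1 + (a - 1) * (1 - x / y)))); last first.
  by rewrite ler_pM2l // powR_gt0.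
rewrite mulrDr mulr1 lerD2l mulrCA ler_pM2l //.
have -> : 1 - x / y = (y - x) / y by field; rewrite gt_eqF.
rewrite mulrA ler_pdivlMr //.
have E : y `^ (1 - a) * y `^ a = y.
  rewrite -powRD ?(gt_eqF y0) ?implybT // (_ : 1 - a + a = 1); last by ring.
  by rewrite powRr1 // ltW.
by rewrite -{1}E mulrCA ler_pM2l // powR_gt0.
Qed.

Lemma decreasing_le u : (forall l, u l.+1 < u l) ->
  forall k l, (k <= l)%N -> u l <= u k.
Proof.
move=> du k l; elim: l => [|l IH]; first by rewrite leqn0 => /eqP ->.
rewrite leq_eqVlt => /orP[/eqP -> //|]; rewrite ltnS => /IH.
by apply: le_trans; exact: ltW.
Qed.

(** With [t := delta `^ a^-1], the terms below [t] have their balls in an interval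
    of length [t + 4 * delta], and there are [O(t `^ (1 - a))] terms above [t],
    whose balls have total measure [O(delta * t `^ (1 - a)) = O(t)]. *)
Lemma measure_neighborhood_le u a c eta : 1 < a -> 0 < c -> 0 < eta ->
  (forall l, 0 < u l) -> (forall l, u l.+1 < u l) ->
  (exists L, u L < eta) ->
  (forall l, u l < eta -> c * u l `^ a <= u l - u l.+1) ->
  exists2 C, 0 < C & \forall delta \near (0 : R)^'+,
    (mu (Defs.neighborhood (range u) delta) <= (C * delta `^ a^-1)%:E)%E.
Proof.
move=> a1 c0 eta0 u0 du [L uL] gap.
have b0 : 0 < a - 1 by rewrite subr_gt0.
have a0 : 0 < a by rewrite (lt_trans ltr01).
pose k := (a - 1) * c; have k0 : 0 < k by rewrite mulr_gt0.
have pot n : n%:R * k <= u (L + n)%N `^ (1 - a).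
  elim: n => [|n IH]; first by rewrite mul0r powR_ge0.
  rewrite -natr1 mulrDl mul1r addnS.
  apply: le_trans (potential_step _ _ _ _ a1 c0 (u0 _) (u0 (L + n)%N) _).
    by rewrite lerD2r.
  apply: gap; apply: le_lt_trans uL; apply: decreasing_le => //.
  exact: leq_addr.
exists (1 + 4 * (L%:R + 2) + 4 / k).
  have : 0 < 4 / k by rewrite divr_gt0.
  by have := ler0n R L; lra.
apply: filterS (near0_lt _ (@ltr01 R)) => delta /andP[d0 d1].
pose t := delta `^ a^-1; have t0 : 0 < t by rewrite powR_gt0.
pose q := t `^ (1 - a) / k.
have q0 : 0 <= q by rewrite divr_ge0 ?powR_ge0 // ltW.
pose n := (Num.truncn q).+1; pose N := (L + n)%N.
have /andP[n0 qn] := truncn_itv q0.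
have n1 : n%:R <= q + 1 by rewrite /n -natr1 lerD2r.
have ut l : (N <= l)%N -> u l <= t.
  move=> Nl; apply: (le_trans (decreasing_le _ du _ _ Nl)).
  rewrite leNgt; apply/negP => tu.
  move: qn; rewrite -/n ltNge /q => /negP; apply; rewrite ler_pdivlMr //.
  apply: (le_trans (pot n)).
  have : (u N)^-1 `^ (a - 1) <= t^-1 `^ (a - 1).
    apply: ge0_ler_powR; rewrite ?nnegrE ?invr_ge0 ?(ltW b0) ?(ltW t0) ?(ltW (u0 _)) //.
    by rewrite lef_pV2 ?posrE // ltW.
  have E x : 0 < x -> x^-1 `^ (a - 1) = x `^ (1 - a).
    by move=> x0; rewrite -powR_inv1 ?(ltW x0) // -powRrM mulN1r opprB.
  by rewrite !E.
have dt : delta <= t.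
  by apply: ger1_powR; rewrite ?d0 ?(ltW d1) // invf_le1 // ltW.
have dq : delta * q = t / k.
  rewrite /q mulrA; congr (_ / _).
  rewrite /t -powRrM -{1}[delta]powRr1 ?(ltW d0) // -powRD ?(gt_eqF d0) ?implybT //.
  by congr (_ `^ _); field; rewrite gt_eqF.
have sub : Defs.neighborhood (range u) delta `<=`
    `[- (2 * delta), t + 2 * delta] `|`
    \big[setU/set0]_(l < N) `[u l - 2 * delta, u l + 2 * delta].
  move=> x; have d2 : delta < 2 * delta by lra.
  move=> /(neighborhood_ex _ _ _ _ d2)[_ [l _ <-]].
  rewrite ltr_norml => /andP[x1 x2].
  have [lN|Nl] := ltnP l N.
    right; rewrite -(bigcup_mkord N
      (fun l => `[(u l - 2 * delta)%R, (u l + 2 * delta)%R]%classic)); exists l => //=; rewrite in_itv /=.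
    apply/andP; split; lra.
  left; rewrite /= in_itv /=; have := ut _ Nl; have := u0 l.
  by move=> ? ?; apply/andP; split; lra.
apply: (@le_trans _ _ ((t + 4 * delta)%:E + (N%:R * (2 * (2 * delta)))%:E)%E).
  have d20 : 0 < 2 * delta by lra.
  have mB : measurable (\big[setU/set0]_(l < N) `[u l - 2 * delta, u l + 2 * delta]).
    by apply: bigsetU_measurable => i _; exact: measurable_itv.
  have := le_measure mu (mem_set (neighborhood_measurable _ _))
    (mem_set (measurableU _ _ (measurable_itv _) mB)) sub.
  move=> /le_trans; apply; apply: (le_trans (measureU2 _ _ _)) => //.
  apply: leeD; last exact: measure_balls_le.
  apply: (@le_trans _ _ (mu `[(- (2 * delta))%R, (t + 2 * delta)%R])).
    exact: lexx.
  by rewrite measure_segment ?lee_fin; lra.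
rewrite -EFinD lee_fin -/t.
have NE : N%:R <= L%:R + (q + 1) by rewrite natrD lerD2l.
have H1 : N%:R * (2 * (2 * delta)) <= (L%:R + (q + 1)) * (2 * (2 * delta)).
  by rewrite ler_wpM2r //; lra.
have H2 : (L%:R + 2) * delta <= (L%:R + 2) * t by rewrite ler_wpM2l // addr_ge0.
have H3 : k^-1 * t = delta * q by rewrite dq mulrC.
have : (1 + 4 * (L%:R + 2) + 4 * k^-1) * t =
  t + 4 * ((L%:R + 2) * t) + 4 * (k^-1 * t) by ring.
rewrite H3 => ->.
have : (L%:R + (q + 1)) * (2 * (2 * delta)) =
  4 * (L%:R * delta) + 4 * (delta * q) + 4 * delta by ring.
move: H1 H2; rewrite mulrDl; lra.
Qed.

(** Below the height [t] with [c * t `^ a = delta] the gaps are at most [delta], so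
    the neighborhood contains everything down to 0. *)
Lemma measure_neighborhood_ge u a c eta : 1 < a -> 0 < c -> 0 < eta ->
  (forall l, 0 < u l) -> (forall l, u l.+1 < u l) ->
  (forall e, 0 < e -> exists L, u L < e) ->
  (forall l, u l < eta -> u l - u l.+1 <= c * u l `^ a) ->
  exists2 C, 0 < C & \forall delta \near (0 : R)^'+,
    ((C * delta `^ a^-1)%:E <= mu (Defs.neighborhood (range u) delta))%E.
Proof.
move=> a1 c0 eta0 u0 du ucv gap.
have b0 : 0 < a - 1 by rewrite subr_gt0.
have a0 : 0 < a by rewrite (lt_trans ltr01).
(* since [a > 1], gaps are at most half the height near 0; thus no step crosses
   from above [t] to below [t / 2] *)
have [eta' [eta'0 eta'_le half]] : exists eta', [/\ 0 < eta', eta' <= eta &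
    forall l, u l < eta' -> u l / 2 <= u l.+1].
  have c2 : 0 < (2 * c)^-1 by rewrite invr_gt0 mulr_gt0.
  have /cvgrPdist_le/(_ _ c2) /near0P[e e0 He] := powR_cvg0 b0.
  exists (Num.min e eta); rewrite lt_min e0 eta0 ge_min lexx orbT; split => // l.
  rewrite lt_min => /andP[le leta].
  have := He _ (u0 l) le; rewrite sub0r normrN ger0_norm ?powR_ge0 //.
  rewrite -[X in _ <= X]mul1r ler_pdivlMr ?mulr_gt0 // => H.
  have := gap _ leta; rewrite -mulr_powRB1 ?(ltW (u0 l)) //.
  have : u l * (u l `^ (a - 1) * (2 * c)) <= u l * 1 by rewrite ler_pM2l.
  have -> : u l * (u l `^ (a - 1) * (2 * c)) = 2 * (c * (u l * u l `^ (a - 1))) by ring.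
  by rewrite mulr1; lra.
have [L uL] := ucv _ eta'0.
exists (c `^ (- a^-1) / 2); first by rewrite divr_gt0 // powR_gt0.
have m0 : 0 < Num.min (u L) eta' by rewrite lt_min u0.
have d10 : 0 < c * (Num.min (u L) eta') `^ a by rewrite mulr_gt0 // powR_gt0.
apply: filterS (near0_lt _ d10) => delta /andP[d0 d1].
pose t := (delta / c) `^ a^-1; have t0 : 0 < t by rewrite powR_gt0 // divr_gt0.
have ta : c * t `^ a = delta.
  rewrite /t -powRrM mulVf ?gt_eqF // powRr1; last by rewrite divr_ge0 ?ltW.
  by rewrite mulrC divfK // gt_eqF.
have tm : t < Num.min (u L) eta'.
  have : t `^ a < Num.min (u L) eta' `^ a by rewrite -(ltr_pM2l c0) ta.
  apply: contraTT; rewrite -!leNgt => H.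
  by apply: ge0_ler_powR; rewrite ?nnegrE // ltW.
have [tL te] : t < u L /\ t < eta' by apply/andP; rewrite -lt_min.
have muI : mu `]0, (t / 2)%R[ = (t / 2)%:E.
  by rewrite lebesgue_measure_itv /= lte_fin divr_gt0 // sube0.
have sub : `]0, t / 2[ `<=` Defs.neighborhood (range u) delta.
  move=> x /=; rewrite in_itv /= => /andP[x0 xt].
  have [k uk] := ucv _ x0.
  have exl : exists l, u l <= x by exists k; exact: ltW.
  pose l := ex_minn exl.
  have [ul lmin] : u l <= x /\ forall m, u m <= x -> (l <= m)%N.
    by rewrite /l; case: ex_minnP.
  have Ll : (L < l)%N.
    rewrite ltnNge; apply/negP => lL.
    have := decreasing_le _ du _ _ lL; lra.
  have [m lE] : exists m, l = m.+1 by exists l.-1; rewrite prednK // (leq_ltn_trans _ Ll).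
  have Lm : (L <= m)%N by rewrite -ltnS -lE.
  have um : x < u m.
    by rewrite ltNge; apply/negP => /lmin; rewrite lE ltnn.
  have ume : u m < eta' by apply: le_lt_trans uL; exact: decreasing_le.
  have umt : u m <= t.
    rewrite leNgt; apply/negP => tu; have := half _ ume; rewrite -lE; lra.
  have := gap _ (lt_le_trans ume eta'_le); rewrite -lE => g.
  have gd : u m - u l <= delta.
    apply: (le_trans g); rewrite -ta ler_pM2l //.
    by apply: ge0_ler_powR; rewrite ?nnegrE // ltW.
  apply: (@neighborhood_ball _ _ _ (u l)); first by exists l.
  by rewrite ger0_norm ?subr_ge0 //; lra.
have := le_measure mu (mem_set (measurable_itv _))
  (mem_set (neighborhood_measurable (range u) delta)) sub.
apply: le_trans.
apply: (@le_trans _ _ (mu `]0, (t / 2)%R[)); last exact: lexx.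
rewrite muI lee_fin mulrAC ler_pM2r // /t powRM ?invr_ge0 ?(ltW d0) ?(ltW c0) //.
by rewrite -(powR_inv1 (ltW c0)) -powRrM mulN1r mulrC.
Qed.

End Sequences.

(** * First nonzero coefficient *)

Section Dichotomy.
Context {R : realType}.
Implicit Types (f D : R -> R) (p q : {poly R}) (x y r d : R).

Lemma poly_lowest p N :
  (exists q, p = q * 'X^N) \/
  exists k q, [/\ (k < N)%N, p = q * 'X^k & q.[0] != 0].
Proof.
elim: N p => [|N IH] p; first by left; exists p; rewrite expr0 mulr1.
have [p0|p0] := eqVneq p.[0] 0; last first.
  by right; exists 0%N, p; split => //; rewrite expr0 mulr1.
have /factor_theorem[p' pE] : root p 0 by rewrite rootE p0.
rewrite subr0 in pE.
have [[q qE]|[k [q [kN qE q0]]]] := IH p'.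
  by left; exists q; rewrite pE qE exprSr mulrA.
by right; exists k.+1, q; split => //; rewrite pE qE exprSr mulrA.
Qed.

(** If [f] is not [O(r ^+ N)], its expansion polynomial to order [N] is not
    divisible by ['X^N], and its lowest monomial, of degree less than [N],
    dominates both the other monomials and the remainder. *)
Lemma expands_dichotomy f : (forall N, expands N f) ->
  (exists k c1 c2, [/\ 0 < c1, 0 < c2 &
    \forall r \near (0 : R)^'+, c1 * r ^+ k <= `|f r| <= c2 * r ^+ k]) \/
  (forall N, exists2 C : R, 0 < C &
    \forall r \near (0 : R)^'+, `|f r| <= C * r ^+ N).
Proof.
move=> fN; have [flat|/existsNP[N nN]] := pselect (forall N, exists2 C : R, 0 < C &
    \forall r \near (0 : R)^'+, `|f r| <= C * r ^+ N); first by right.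
left; have [p [C [C0 Hp]]] := expands_pos _ _ (fN N).
have [[q pE]|[k [q [kN pE q0]]]] := poly_lowest p N.
  exfalso; apply: nN; have [K K0 HK] := horner_bounded q.
  exists (C + K); first by rewrite addr_gt0.
  move: Hp (near0_lt _ (@ltr01 R)); apply: filterS2 => r fr /andP[r0 r1].
  rewrite -(subrK p.[r] (f r)) (le_trans (ler_normD _ _)) // mulrDl lerD //.
  rewrite pE hornerM hornerXn normrM [`|r ^+ N|]gtr0_norm ?exprn_gt0 //.
  by rewrite ler_pM2r ?exprn_gt0 // HK // (ltW r0) (ltW r1).
pose a := `|q.[0]|; have a0 : 0 < a by rewrite normr_gt0.
exists k, (a / 2), (2 * a); split; [exact: divr_gt0|exact: mulr_gt0|].
have a4 : 0 < a / 4 by rewrite divr_gt0.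
have /cvgrPdist_le/(_ _ a4) Hq := cvg_at_right_filter (@continuous_horner R q 0).
have aC : 0 < a / 4 / C by rewrite divr_gt0.
move: (near0_and _ _ Hp Hq) (near0_lt _ (@ltr01 R)) (near0_lt _ aC).
apply: filterS3 => r [fr qr] /andP[r0 r1] /andP[_ rC].
have rk0 : 0 < r ^+ k by rewrite exprn_gt0.
have fr' : `|f r - p.[r]| <= a / 4 * r ^+ k.
  apply: (le_trans fr); apply: (@le_trans _ _ (C * r ^+ k.+1)).
    by rewrite ler_pM2l // ler_wiXn2l // ltW.
  rewrite exprS mulrA ler_pM2r //.
  by move: rC; rewrite ltr_pdivlMr // mulrC => /ltW.
have pr : `|p.[r] - q.[0] * r ^+ k| <= a / 4 * r ^+ k.
  rewrite pE hornerM hornerXn -mulrBl normrM [`|r ^+ k|]gtr0_norm //.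
  by rewrite ler_pM2r // distrC.
have E : `|q.[0] * r ^+ k| = a * r ^+ k by rewrite normrM [`|r ^+ k|]gtr0_norm.
have H : `|f r - q.[0] * r ^+ k| <= a / 2 * r ^+ k.
  rewrite -(subrKA p.[r]) (le_trans (ler_normD _ _)) //.
  have -> : a / 2 * r ^+ k = a / 4 * r ^+ k + a / 4 * r ^+ k by field.
  exact: lerD.
have ark : 0 < a * r ^+ k by rewrite mulr_gt0.
have H1 := lerB_dist (f r) (q.[0] * r ^+ k).
have H2 := lerB_dist (q.[0] * r ^+ k) (f r).
rewrite distrC in H2; rewrite E in H1 H2.
have Eh : a / 2 * r ^+ k = (a * r ^+ k) / 2 by field.
by rewrite Eh in H *; rewrite -mulrA; apply/andP; split; lra.
Qed.

Lemma near0_sqrt (P : R -> Prop) : (\forall r \near (0 : R)^'+, P r) ->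
  \forall y \near (0 : R)^'+, P (Num.sqrt y).
Proof.
move=> /near0P[e e0 H].
apply: filterS (near0_lt _ (exprn_gt0 2 e0)) => y /andP[y0 ye].
apply: H; first by rewrite sqrtr_gt0.
by rewrite -[ltRHS](ger0_norm (ltW e0)) -sqrtr_sqr ltr_sqrt // exprn_gt0.
Qed.

Lemma sqrt_exp y k : 0 < y -> Num.sqrt y ^+ k = y `^ (k%:R / 2).
Proof.
move=> y0; rewrite -powR12_sqrt ?(ltW y0) // -powR_mulrn ?powR_ge0 //.
by rewrite -powRrM mulrC.
Qed.

(** [d] is the dimension of a sequence whose gap at height [y] is comparable to
    [|D y|]: for gaps of order [y `^ a] it is [1 - 1 / a], here with [a = k / 2],
    and the flat case is the limit [a = +oo]. *)
Definition power_or_flat D d :=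
  (exists k c1 c2, [/\ (1 < k)%N, 0 < c1, 0 < c2, d = (k%:R - 2) / k%:R &
    \forall y \near (0 : R)^'+,
      c1 * y `^ (k%:R / 2) <= `|D y| <= c2 * y `^ (k%:R / 2)]) \/
  (d = 1 /\ forall N, exists2 C : R, 0 < C &
    \forall y \near (0 : R)^'+, `|D y| <= C * y `^ (N%:R / 2)).

Lemma expands_power_or_flat D (K : R) :
  (\forall r \near (0 : R)^'+, `|D (r ^+ 2)| <= K * r ^+ 2) ->
  (forall N, expands N (fun r => D (r ^+ 2))) ->
  exists d, power_or_flat D d.
Proof.
move=> DK /expands_dichotomy[[k [c1 [c2 [c10 c20 H]]]]|H]; last first.
  exists 1; right; split => // N; have [C C0 HN] := H N; exists C => //.
  move: (near0_sqrt _ HN) (near0_lt _ (@ltr01 R)).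
  apply: filterS2 => y + /andP[y0 _].
  by rewrite sqr_sqrtr ?(ltW y0) // sqrt_exp.
have H' : \forall y \near (0 : R)^'+,
    c1 * y `^ (k%:R / 2) <= `|D y| <= c2 * y `^ (k%:R / 2).
  move: (near0_sqrt _ H) (near0_lt _ (@ltr01 R)).
  apply: filterS2 => y + /andP[y0 _].
  by rewrite sqr_sqrtr ?(ltW y0) // sqrt_exp.
exists ((k%:R - 2) / k%:R); left; exists k, c1, c2; split => //.
(* [k <= 1] is excluded by [D y = O(y)] *)
rewrite ltnNge; apply/negP => k1.
have cK : 0 < c1 / (`|K| + 1) by rewrite divr_gt0 // ltr_wpDl.
have [r [[/andP[Hr _] rK] [/andP[r0 r1] /andP[_ rc]]]] :=
  near0_ex _ (near0_and _ _ (near0_and _ _ H DK)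
    (near0_and _ _ (near0_lt _ (@ltr01 R)) (near0_lt _ cK))).
have rk : r <= r ^+ k by rewrite -[leLHS]expr1 ler_wiXn2l // ltW.
have : c1 * r <= `|K| * r * r.
  apply: (@le_trans _ _ (c1 * r ^+ k)); first by rewrite ler_pM2l.
  rewrite (le_trans Hr) // (le_trans rK) // -mulrA -expr2.
  by rewrite ler_wpM2r ?ler_norm // exprn_ge0 // ltW.
rewrite ler_pM2r // leNgt => /negP; apply.
rewrite ltr_pdivlMr ?ltr_wpDl // in rc; apply: le_lt_trans rc.
by rewrite mulrDr mulr1 mulrC lerDl ltW.
Qed.

End Dichotomy.

(** * Dimension of an orbit in terms of its gaps *)

Section OrbitDimension.
Context {R : realType}.
Implicit Types (u : nat -> R) (D : R -> R) (d : R).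

Lemma has_dim_intro (U : set R) d :
  (d%:E <= lower_minkowski_dim U)%E -> (upper_minkowski_dim U <= d%:E)%E ->
  has_minkowski_dim U d.
Proof.
move=> dl ud; have lu := lower_dim_le_upper U.
split; apply/eqP; rewrite eq_le.
  by rewrite dl (le_trans lu ud).
by rewrite ud (le_trans dl lu).
Qed.

Lemma nondegenerate_intro (U : set R) d c C : 0 <= d -> 0 < c ->
  (\forall delta \near (0 : R)^'+, ((c * delta `^ (1 - d))%:E <=
     lebesgue_measure (Defs.neighborhood U delta))%E) ->
  (\forall delta \near (0 : R)^'+, (lebesgue_measure (Defs.neighborhood U delta)
     <= (C * delta `^ (1 - d))%:E)%E) ->
  minkowski_nondegenerate U.
Proof.
move=> d0 c0 Hl Hu; exists d; split => //.
- by apply: lt_le_trans (lower_content_ge _ _ _ Hl); rewrite lte_fin.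
- exact: lower_content_le_upper.
- by apply: le_lt_trans (upper_content_le _ _ _ Hu) _; rewrite ltry.
Qed.

Lemma upper_dim_le1 u : (forall l, 0 < u l) -> (forall l, u l.+1 < u l) ->
  (upper_minkowski_dim (range u) <= 1%:E)%E.
Proof.
move=> u0 du; have C0 : 0 < u 0%N + 4 by rewrite addr_gt0.
apply: (upper_dim_le _ _ _ ler01 C0).
apply: filterS (near0_lt _ (@ltr01 R)) => delta /andP[d0 d1].
rewrite subrr powRr0 mulr1.
have sub : Defs.neighborhood (range u) delta `<=` `[-2, u 0%N + 2].
  move=> x; have d2 : delta < 2 by lra.
  move=> /(neighborhood_ex _ _ _ _ d2)[_ [l _ <-]].
  rewrite ltr_norml => /andP[x1 x2]; rewrite /= in_itv /=.
  have := u0 l; have := decreasing_le _ du _ _ (leq0n l).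
  by move=> ? ?; apply/andP; split; lra.
have := le_measure lebesgue_measure (mem_set (neighborhood_measurable _ _))
  (mem_set (measurable_itv _)) sub.
move/le_trans; apply.
apply: (@le_trans _ _ (lebesgue_measure `[(-2 : R), u 0%N + 2])); first exact: lexx.
by rewrite measure_segment ?lee_fin; have := u0 0%N; lra.
Qed.

Context (u : nat -> R) (D : R -> R) (d K1 K2 : R).
Context (K10 : 0 < K1) (K20 : 0 < K2) (u0 : forall l, 0 < u l)
  (du : forall l, u l.+1 < u l) (ucv : forall e, 0 < e -> exists L, u L < e)
  (gap : forall l, K1 * (u l - u l.+1) <= `|D (u l)| <= K2 * (u l - u l.+1)).

Let gap_ge a c : 0 < c ->
  (\forall y \near (0 : R)^'+, c * y `^ a <= `|D y|) ->
  exists2 eta, 0 < eta &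
    forall l, u l < eta -> c / K2 * u l `^ a <= u l - u l.+1.
Proof.
move=> c0 /near0P[e e0 H]; exists e => // l ue.
have /andP[_ g] := gap l.
rewrite mulrAC ler_pdivrMr // mulrC [leRHS]mulrC.
by rewrite mulrC (le_trans (H _ (u0 l) ue)).
Qed.

Let gap_le a c : 0 < c ->
  (\forall y \near (0 : R)^'+, `|D y| <= c * y `^ a) ->
  exists2 eta, 0 < eta &
    forall l, u l < eta -> u l - u l.+1 <= c / K1 * u l `^ a.
Proof.
move=> c0 /near0P[e e0 H]; exists e => // l ue.
have /andP[g _] := gap l.
rewrite [leRHS]mulrAC ler_pdivlMr // mulrC.
exact: le_trans (H _ (u0 l) ue).
Qed.

Let measure_le a c : 1 < a -> 0 < c ->
  (\forall y \near (0 : R)^'+, c * y `^ a <= `|D y|) ->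
  exists2 C, 0 < C & \forall delta \near (0 : R)^'+,
    (lebesgue_measure (Defs.neighborhood (range u) delta)
      <= (C * delta `^ (1 - (1 - a^-1)))%:E)%E.
Proof.
move=> a1 c0 H; have [eta eta0 g] := gap_ge _ _ c0 H.
have [||C C0 HC] := measure_neighborhood_le u a (c / K2) eta a1 _ eta0 u0 du _ g.
- exact: divr_gt0.
- exact: ucv.
exists C => //; move: HC; apply: filterS => delta.
by rewrite subKr.
Qed.

Let measure_ge a c : 1 < a -> 0 < c ->
  (\forall y \near (0 : R)^'+, `|D y| <= c * y `^ a) ->
  exists2 C, 0 < C & \forall delta \near (0 : R)^'+,
    ((C * delta `^ (1 - (1 - a^-1)))%:E <=
    lebesgue_measure (Defs.neighborhood (range u) delta))%E.
Proof.
move=> a1 c0 H; have [eta eta0 g] := gap_le _ _ c0 H.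
have [|C C0 HC] := measure_neighborhood_ge u a (c / K1) eta a1 _ eta0 u0 du ucv g.
  exact: divr_gt0.
exists C => //; move: HC; apply: filterS => delta.
by rewrite subKr.
Qed.

(** The two-sided estimate of the measure needs an exponent [a > 1]; the
    borderline exponent 1 and the flat case are reached as limits of one-sided
    estimates. *)
Lemma orbit_dimension : power_or_flat D d ->
  has_minkowski_dim (range u) d /\
  (d <> 0 -> d <> 1 -> minkowski_nondegenerate (range u)).
Proof.
move=> [[k [c1 [c2 [k1 c10 c20 dE H]]]]|[-> flat]]; last first.
  split=> //; apply: has_dim_intro; last exact: upper_dim_le1.
  apply/lee_addgt0Pr => e e0; rewrite -leeBlDr // -EFinB.
  (* [N] is chosen so that the lower bound [1 - 2 / N] exceeds [1 - e] *)
  pose N := (Num.truncn (2 / e + 2)).+1.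
  have N2 : 2 / e + 2 < N%:R.
    have /truncn_itv/andP[_] : 0 <= 2 / e + 2 by rewrite addr_ge0 // divr_ge0 // ltW.
    by [].
  have e2 : 0 < 2 / e by rewrite divr_gt0.
  have a1 : 1 < N%:R / 2 :> R by rewrite ltr_pdivlMr // mul1r; lra.
  have [C C0 HN] := flat N.
  have [c c0 Hc] := measure_ge _ _ a1 C0 HN.
  apply: le_trans (lower_dim_ge _ _ _ c0 Hc); rewrite lee_fin.
  rewrite lerD2l lerN2 invf_div ler_pdivrMr; last lra.
  by rewrite mulrC -ler_pdivrMr //; lra.
have H1 : \forall y \near (0 : R)^'+, c1 * y `^ (k%:R / 2) <= `|D y|.
  by move: H; apply: filterS => y /andP[].
have H2 : \forall y \near (0 : R)^'+, `|D y| <= c2 * y `^ (k%:R / 2).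
  by move: H; apply: filterS => y /andP[].
have kR : 2 <= k%:R :> R by rewrite ler_nat.
move: k1; rewrite leq_eqVlt => /orP[/eqP k2|k2].
  (* linear gaps: compare with every exponent [a > 1] *)
  have d0 : d = 0 by rewrite dE -k2 subrr mul0r.
  rewrite d0; split=> //; apply: has_dim_intro; first exact: lower_dim_ge0.
  apply/lee_addgt0Pr => e e0; rewrite add0e.
  pose e' := Num.min e 2^-1.
  have e'0 : 0 < e' by rewrite lt_min e0 invr_gt0 ltr0n.
  have e'1 : e' <= 2^-1 by rewrite ge_min lexx orbT.
  have h1 : e' < 1 by apply: (le_lt_trans e'1); rewrite invf_lt1 // ltr1n.
  have s0 : 0 < 1 - e' by rewrite subr_gt0.
  have a1 : 1 < (1 - e')^-1 by rewrite invf_gt1 //; lra.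
  have H1' : \forall y \near (0 : R)^'+, c1 * y `^ (1 - e')^-1 <= `|D y|.
    move: H1 (near0_lt _ (@ltr01 R)); apply: filterS2 => y + /andP[y0 y1].
    rewrite -k2 divff // => h; apply: le_trans h; rewrite ler_pM2l //.
    by apply: ger_powR; rewrite ?y0 ltW.
  have [C C0 HC] := measure_le _ _ a1 c10 H1'.
  have e'E : 1 - ((1 - e')^-1)^-1 = e' by rewrite invrK subKr.
  rewrite e'E in HC.
  apply: (le_trans (upper_dim_le _ _ _ (ltW e'0) C0 HC)).
  by rewrite lee_fin ge_min lexx.
have k3 : 3 <= k%:R :> R by rewrite ler_nat.
have a1 : 1 < k%:R / 2 :> R by rewrite ltr_pdivlMr // mul1r; lra.
have dE' : d = 1 - (k%:R / 2)^-1.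
  by rewrite dE invf_div; field; rewrite gt_eqF //; lra.
have d0 : 0 <= d by rewrite dE divr_ge0; lra.
have [C C0 HC] := measure_le _ _ a1 c10 H1.
have [c c0 Hc] := measure_ge _ _ a1 c20 H2.
rewrite -dE' in HC Hc.
split; last by move=> _ _; exact: (nondegenerate_intro _ _ _ _ d0 c0 Hc HC).
apply: has_dim_intro; first exact: (lower_dim_ge _ _ _ c0 Hc).
exact: (upper_dim_le _ _ _ d0 C0 HC).
Qed.

End OrbitDimension.

(** * Orbits of the slow relation function *)

Section Orbits.
Context {R : realType}.
Implicit Types (A B D : R -> R) (u : nat -> R) (x y : R).

Lemma germ_bounds_weaken A (y1 K1 K2 y1' K1' K2' : R) :
  germ_bounds A y1 K1 K2 -> 0 < y1' <= y1 -> 0 < K1' <= K1 -> K2 <= K2' ->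
  germ_bounds A y1' K1' K2'.
Proof.
move=> [y10 K10 K20 H1 H2] /andP[y1'0 y1y] /andP[K1'0 K1K] K2K.
split=> //; first exact: lt_le_trans K2K.
  move=> y' y y'0 y'y yy1.
  have /andP[h1 h2] := H1 _ _ y'0 y'y (lt_le_trans yy1 y1y).
  have yy : 0 <= y - y' by rewrite subr_ge0 ltW.
  apply/andP; split.
    by apply: le_trans h1; rewrite ler_wpM2r.
  by apply: (le_trans h2); rewrite ler_wpM2r.
move=> y y0 yy1; have /andP[h1 h2] := H2 _ y0 (lt_le_trans yy1 y1y).
apply/andP; split.
  by apply: le_trans h1; rewrite ler_pM2r.
by apply: (le_trans h2); rewrite ler_pM2r.
Qed.

Lemma germ_bounds_continuous A (y1 K1 K2 : R) : germ_bounds A y1 K1 K2 ->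
  forall x, 0 < x -> x < y1 -> {for x, continuous A}.
Proof.
move=> [y10 K10 K20 H1 H2] x x0 xy1.
apply/cvgrPdist_le => e e0.
have d0 : 0 < e / K2 by rewrite divr_gt0.
have n1 : \forall t \near x, 0 < t by exact: lt_nbhsr.
have n2 : \forall t \near x, t < y1 by exact: lt_nbhsl.
have n3 : \forall t \near x, `|x - t| < e / K2.
  by have := nbhsx_ballx x _ d0; apply: filterS => t.
near=> t.
have t0 : 0 < t by near: t.
have t1 : t < y1 by near: t.
have : `|x - t| < e / K2 by near: t.
rewrite ltr_pdivlMr // => /ltW xt; apply: le_trans xt; rewrite [leRHS]mulrC.
have [xt|tx|->] := ltgtP x t; last by rewrite !subrr !normr0 mulr0.
  have /andP[h1 h2] := H1 _ _ x0 xt t1.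
  have p : 0 < t - x by rewrite subr_gt0.
  rewrite ger0_norm; last by apply: le_trans h1; rewrite mulr_ge0 // ltW.
  by rewrite distrC gtr0_norm.
have /andP[h1 h2] := H1 _ _ t0 tx xy1.
have p : 0 < x - t by rewrite subr_gt0.
rewrite distrC ger0_norm; last by apply: le_trans h1; rewrite mulr_ge0 // ltW.
by rewrite gtr0_norm.
Unshelve. all: by end_near. Qed.

Lemma constant_sign D (ystar : R) :
  (forall x, 0 < x -> x < ystar -> {for x, continuous D}) ->
  (forall y, 0 < y < ystar -> D y <> 0) ->
  (forall y, 0 < y < ystar -> 0 < D y) \/ (forall y, 0 < y < ystar -> D y < 0).
Proof.
move=> cD D0; have [|/existsNP[a /not_implyP[a01 Da]]] :=
  pselect (forall y, 0 < y < ystar -> 0 < D y); first by left.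
right=> b b01; rewrite ltNge; apply/negP => Db.
have {}Da : D a < 0.
  by rewrite lt_neqAle; apply/andP; split; [exact/eqP/D0|rewrite leNgt; exact/negP].
have {}Db : 0 < D b.
  by rewrite lt_neqAle Db andbT eq_sym; exact/eqP/D0.
move/andP: a01 => [a0 a1]; move/andP: b01 => [b0 b1].
have key s t : 0 < s -> s <= t -> t < ystar ->
    Num.min (D s) (D t) <= 0 <= Num.max (D s) (D t) -> False.
  move=> s0 st t1 D0m.
  have cw : {within `[s, t], continuous D}.
    apply: continuous_in_subspaceT => z; rewrite inE /= in_itv /= => /andP[sz zt].
    by apply: cD; [exact: lt_le_trans sz|exact: le_lt_trans t1].
  have [z + Dz] := IVT st cw D0m.
  rewrite in_itv /= => /andP[sz zt]; apply: (D0 z) => //.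
  by rewrite (lt_le_trans s0 sz) (le_lt_trans zt t1).
have [ab|/ltW ba] := leP a b.
  by apply: (key a b) => //; rewrite ge_min le_max (ltW Da) (ltW Db) orbT.
by apply: (key b a) => //; rewrite ge_min le_max (ltW Da) (ltW Db) orbT.
Qed.

Context (A B : R -> R) (y1 K1 K2 ystar : R).
Context (hA : germ_bounds A y1 K1 K2) (hB : germ_bounds B y1 K1 K2)
  (ysy1 : ystar < y1) (AB : forall y, 0 < y < ystar -> B y < A y).

Let K10 : 0 < K1. Proof. by case: hA. Qed.
Let K20 : 0 < K2. Proof. by case: hA. Qed.

Let B_anti x y : 0 < x -> x < y -> y < y1 -> B y < B x.
Proof.
move=> x0 xy yy; have [_ _ _ H _] := hB.
have /andP[h _] := H _ _ x0 xy yy.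
rewrite -subr_gt0; apply: lt_le_trans h.
by rewrite mulr_gt0 // subr_gt0.
Qed.

(** [B y < A y < 0], and [B] tends to 0 at 0. *)
Lemma slow_relation_exists y : 0 < y < ystar ->
  exists z, 0 < z < ystar /\ B z = A y.
Proof.
move=> /[dup] y01 /andP[y0 yy].
have [_ _ _ _ HA] := hA; have [_ _ _ _ HB] := hB.
have yy1 := lt_trans yy ysy1.
have Ay : 0 < - A y.
  by have /andP[h _] := HA _ y0 yy1; apply: lt_le_trans h; rewrite mulr_gt0.
pose e := Num.min y (- A y / K2).
have e0 : 0 < e by rewrite lt_min y0 divr_gt0.
have ey : e <= y by rewrite ge_min lexx.
have Be : A y <= B e.
  have /andP[_ h] := HB _ e0 (le_lt_trans ey yy1).
  rewrite -lerN2 (le_trans h) // mulrC -ler_pdivlMr //.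
  by rewrite ge_min lexx orbT.
have cw : {within `[e, y], continuous B}.
  apply: continuous_in_subspaceT => z; rewrite inE /= in_itv /= => /andP[ez zy].
  apply: (germ_bounds_continuous _ _ _ _ hB).
    exact: lt_le_trans ez.
  exact: le_lt_trans yy1.
have : Num.min (B e) (B y) <= A y <= Num.max (B e) (B y).
  by rewrite ge_min le_max Be (ltW (AB _ y01)) orbT.
move=> /(IVT ey cw)[z]; rewrite in_itv /= => /andP[ez zy] Bz.
by exists z; rewrite (lt_le_trans e0 ez) (le_lt_trans zy yy).
Qed.

Lemma orbit_exists y0 : 0 < y0 < ystar -> exists u : nat -> R,
  [/\ u 0%N = y0, forall l, 0 < u l < ystar & forall l, B (u l.+1) = A (u l)].
Proof.
move=> y01.
have step (s : {y : R | 0 < y < ystar}) :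
    {t : {y : R | 0 < y < ystar} | B (sval t) = A (sval s)}.
  apply: cid; have [z [z01 Bz]] := slow_relation_exists _ (svalP s).
  by exists (exist _ z z01).
pose v l := iter l (fun s => sval (step s)) (exist _ y0 y01).
exists (fun l => sval (v l)); split => // l; first exact: (proj2_sig (v l)).
exact: (proj2_sig (step (v l))).
Qed.

Section OneOrbit.
Context (u : nat -> R) (u01 : forall l, 0 < u l < ystar)
  (uE : forall l, B (u l.+1) = A (u l)).

Let u0 l : 0 < u l. Proof. by have /andP[] := u01 l. Qed.
Let uy1 l : u l < y1.
Proof. by have /andP[_ h] := u01 l; exact: lt_trans ysy1. Qed.

Lemma orbit_decreasing l : u l.+1 < u l.
Proof.
have ABl := AB _ (u01 l); rewrite -uE in ABl.
rewrite ltNge; apply/negP; rewrite le_eqVlt => /orP[/eqP E|lt].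
  by move: ABl; rewrite -E ltxx.
have := B_anti _ _ (u0 l) lt (uy1 _).
by move=> /(lt_trans ABl); rewrite ltxx.
Qed.

(** [A (u l) = B (u l.+1)], so the middle term is an increment of [B]. *)
Lemma orbit_gap l :
  K1 * (u l - u l.+1) <= A (u l) - B (u l) <= K2 * (u l - u l.+1).
Proof.
rewrite -uE; have [_ _ _ H _] := hB.
by apply: H => //; exact: orbit_decreasing.
Qed.

(** At a positive limit [L] the gaps would stay above [(A L - B L) / (2 * K2)]. *)
Lemma orbit_to0 e : 0 < e -> exists L, u L < e.
Proof.
move=> e0; apply: contrapT => /forallNP ue.
have {}ue l : e <= u l by rewrite leNgt; apply/negP/ue.
have hinf : has_inf (range u).
  by split; [exists (u 0%N), 0%N|exists e => _ [l _ <-]].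
pose L := inf (range u).
have Lu l : L <= u l by apply: ge_inf; [exact: hinf.2|exists l].
have L0 : 0 < L.
  apply: (lt_le_trans e0); apply: lb_le_inf; first exact: hinf.1.
  by move=> _ [l _ <-].
have Ly : L < ystar by apply: (le_lt_trans (Lu 0%N)); have /andP[] := u01 0%N.
have Ly1 := lt_trans Ly ysy1.
pose g := A L - B L.
have g0 : 0 < g by rewrite subr_gt0 AB // L0.
have d0 : 0 < g / (2 * K2) by rewrite divr_gt0 // mulr_gt0.
have [_ [l _ <-] ul] := inf_adherent d0 hinf.
rewrite -/L in ul.
have ulL : u l - L < g / (2 * K2) by lra.
have /andP[_ gl] := orbit_gap l.
have Lul : L < u l by apply: (le_lt_trans (Lu l.+1)); exact: orbit_decreasing.
have [_ _ _ HA _] := hA.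
have /andP[_ h] := HA _ _ L0 Lul (uy1 l).
have Bl := B_anti _ _ L0 Lul (uy1 l).
have Kd : K2 * (u l - L) < g / 2.
  have -> : g / 2 = K2 * (g / (2 * K2)) by field; rewrite gt_eqF.
  by rewrite ltr_pM2l.
have Kd' : K2 * (u l - u l.+1) <= K2 * (u l - L) by rewrite ler_pM2l // lerD2l lerN2.
rewrite /g in Kd; lra.
Qed.

Lemma orbit_has_dimension d : power_or_flat (fun y => A y - B y) d ->
  has_minkowski_dim (range u) d /\
  (d <> 0 -> d <> 1 -> minkowski_nondegenerate (range u)).
Proof.
apply: (orbit_dimension u _ d K1 K2) => //.
- exact: orbit_decreasing.
- exact: orbit_to0.
- move=> l; rewrite gtr0_norm ?subr_gt0 ?AB //; exact: orbit_gap.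
Qed.

End OneOrbit.
End Orbits.

Theorem theorem3p1 (R : realType) (Fm Gm Fp Gp : R -> R)
    (hm : lienard_half Fm Gm) (hp : lienard_half Fp Gp) :
  \forall ystar \near (0 : R)^'+,
    (forall y : R, 0 < y < ystar -> slow_divergence Fm Gm Fp Gp y <> 0) ->
    exists d : R,
      ((exists2 m : nat, (1 <= m)%N & d = (m%:R - 1) / (m%:R + 1)) \/ d = 1) /\
      forall y0 : R, 0 < y0 < ystar ->
        (exists u : nat -> R, entry_exit_orbit Fm Gm Fp Gp ystar y0 u) /\
        forall u : nat -> R, entry_exit_orbit Fm Gm Fp Gp ystar y0 u ->
          has_minkowski_dim (range u) d /\
          (d <> 0 -> d <> 1 -> minkowski_nondegenerate (range u)).
Proof.
set M := Iminus Fm Gm; set P := Iplus Fp Gp.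
have [[ym [km [Km gM]]] eM] := Iminus_divergence_germ _ _ hm.
have [[yp [kp [Kp gP]]] eP] := Iplus_divergence_germ _ _ hp.
pose y1 := Num.min ym yp; pose K1 := Num.min km kp; pose K2 := Num.max Km Kp.
have [ym0 km0 _ _ _] := gM; have [yp0 kp0 _ _ _] := gP.
have y10 : 0 < y1 by rewrite lt_min ym0.
have {}gM : germ_bounds M y1 K1 K2.
  apply: germ_bounds_weaken gM _ _ _.
  - by rewrite y10 ge_min lexx.
  - by rewrite lt_min km0 kp0 ge_min lexx.
  - by rewrite le_max lexx.
have {}gP : germ_bounds P y1 K1 K2.
  apply: germ_bounds_weaken gP _ _ _.
  - by rewrite y10 ge_min lexx orbT.
  - by rewrite lt_min km0 kp0 ge_min lexx orbT.
  - by rewrite le_max lexx orbT.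
pose D y := P y - M y.
have eD N : expands N (fun r => D (r ^+ 2)) by exact: expandsD (eP N) (expandsN _ _ (eM N)).
have DK : \forall r \near (0 : R)^'+, `|D (r ^+ 2)| <= (2 * K2) * r ^+ 2.
  have s0 : 0 < Num.sqrt y1 by rewrite sqrtr_gt0.
  apply: filterS (near0_lt _ s0) => r /andP[r0 rs].
  have r20 : 0 < r ^+ 2 by rewrite exprn_gt0.
  have r2y : r ^+ 2 < y1.
    by rewrite -[ltRHS]sqr_sqrtr ?(ltW y10) // ltr_pXn2r // nnegrE ltW.
  have [_ K10 _ _ HM] := gM; have [_ _ _ _ HP] := gP.
  have /andP[m1 m2] := HM _ r20 r2y; have /andP[p1 p2] := HP _ r20 r2y.
  have : 0 < K1 * r ^+ 2 by rewrite mulr_gt0.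
  rewrite /D ler_norml -mulrA; move: (K1 * _) (K2 * _) m1 m2 p1 p2 => k K *.
  by apply/andP; split; lra.
have [d dD] := expands_power_or_flat _ _ DK eD.
have dE : (exists2 m : nat, (1 <= m)%N & d = (m%:R - 1) / (m%:R + 1)) \/ d = 1.
  case: (dD) => [[k [_ [_ [k1 _ _ -> _]]]]|[-> _]]; last by right.
  case: k k1 => // k k1; left; exists k => //.
  by rewrite -natr1; congr (_ / _); ring.
apply: filterS (near0_lt _ y10) => ystar /andP[ystar0 ysy1] I0.
exists d; split => // y0 y001.
have cD x : 0 < x -> x < ystar -> {for x, continuous D}.
  move=> x0 xs; have xy := lt_trans xs ysy1; apply: cvgB.
    exact: germ_bounds_continuous gP _ x0 xy.
  exact: germ_bounds_continuous gM _ x0 xy.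
have [Dpos|Dneg] := constant_sign D ystar cD I0.
  have MP y : 0 < y < ystar -> M y < P y by move=> /Dpos; rewrite subr_gt0.
  split.
    have [u [u0 u01 uE]] := orbit_exists _ _ _ _ _ _ gP gM ysy1 MP _ y001.
    exists u; split => // /(_ _ y001) Ineg.
    by have := Dpos _ y001; rewrite ltNge ltW.
  move=> u [_ u01 /(_ Dpos) uE _].
  exact: (orbit_has_dimension _ _ _ _ _ _ gP gM ysy1 MP u u01 uE).
have PM y : 0 < y < ystar -> P y < M y by move=> /Dneg; rewrite subr_lt0.
have dD' : power_or_flat (fun y => M y - P y) d.
  have E y : `|M y - P y| = `|D y| by rewrite distrC.
  case: dD => [[k [c1 [c2 [k1 c10 c20 dk H]]]]|[d1 H]].
    by left; exists k, c1, c2; split => //; move: H; apply: filterS => y; rewrite E.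
  right; split => // N; have [C C0 HN] := H N; exists C => //.
  by move: HN; apply: filterS => y; rewrite E.
split.
  have [u [u0 u01 uE]] := orbit_exists _ _ _ _ _ _ gM gP ysy1 PM _ y001.
  exists u; split => // /(_ _ y001) Ipos.
  by have := Dneg _ y001; rewrite ltNge ltW.
move=> u [_ u01 _ /(_ Dneg) uE].
exact: (orbit_has_dimension _ _ _ _ _ _ gM gP ysy1 PM u u01 (fun l => esym (uE l))).
Qed.
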